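(* Let $(M,\mathcal X)\models\mathsf{GBC}$ be countable. Then the collection $\{\mathcal Y\subseteq\mathcal P(M) : (M,\mathcal Y)\models\mathsf{GBC}\text{ and }\mathcal X\subsetneq\mathcal Y\}$, ordered by inclusion, has minimal elements.
   Context: Models of second-order set theory are pairs $(M,\mathcal X)$, where $M$ is a model of first-order set theory (the sets) and $\mathcal X\subseteq\mathcal P(M)$ (the classes), membership between sets and classes being actual membership. $\mathsf{GB}$ consists of $\mathsf{ZF}$ for the sets, Extensionality for classes, Class Replacement (the image of a set under a class function is a set), and Elementary Comprehension (for every formula without class quantifiers, with set and class parameters, the class it defines exists). $\mathsf{GBC}$ is $\mathsf{GB}$ plus Global Choice (there is a class bijection between $V$ and $\mathrm{Ord}$). A model $(M,\mathcal X)$ is countable if $M$ and $\mathcal X$ are countable. *)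

(* Defs.v *)
From mathcomp Require Import all_boot.
From mathcomp Require Import classical_sets cardinality.

Set Implicit Arguments.
Unset Strict Implicit.
Unset Printing Implicit Defensive.

Local Open Scope classical_set_scope.

(* Formulas of two-sorted second-order set theory without class quantifiers.
   Set variables are de Bruijn indices bound by [f_all]; class variables are
   always free, numbered separately. *)
Inductive formula : Type :=
| f_eq (i j : nat)
| f_mem (i j : nat)
| f_cmem (i k : nat)
| f_ceq (k l : nat)
| f_false
| f_imp (phi psi : formula)
| f_all (phi : formula).

Fixpoint class_vars (phi : formula) : seq nat :=
  match phi with
  | f_cmem _ k => [:: k]
  | f_ceq k l => [:: k; l]
  | f_imp phi psi => class_vars phi ++ class_vars psi
  | f_all phi => class_vars phi
  | _ => [::]
  end.

Definition first_order (phi : formula) : Prop := class_vars phi = [::].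

Definition scons {T : Type} (x : T) (s : nat -> T) (n : nat) : T :=
  if n is n'.+1 then s n' else x.

Section Model.
Variables (M : Type) (E : M -> M -> Prop).

Fixpoint sat (phi : formula) (s : nat -> M) (S : nat -> set M) : Prop :=
  match phi with
  | f_eq i j => s i = s j
  | f_mem i j => E (s i) (s j)
  | f_cmem i k => S k (s i)
  | f_ceq k l => S k = S l
  | f_false => False
  | f_imp phi psi => sat phi s S -> sat psi s S
  | f_all phi => forall x, sat phi (scons x s) S
  end.

(* For first-order formulas the class assignment is irrelevant. *)
Definition sat_fo (phi : formula) (s : nat -> M) : Prop :=
  sat phi s (fun=> set0).

Definition subset_in (x y : M) : Prop := forall z, E z x -> E z y.

Definition is_upair (p x y : M) : Prop := forall z, E z p <-> z = x \/ z = y.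

(* Kuratowski pair. *)
Definition is_pair (p x y : M) : Prop :=
  forall z, E z p <-> is_upair z x x \/ is_upair z x y.

Definition is_ordinal (a : M) : Prop :=
  [/\ forall x, E x a -> subset_in x a,
      forall x, E x a -> ~ E x x,
      forall x y z, E x a -> E y a -> E z a -> E x y -> E y z -> E x z,
      forall x y, E x a -> E y a -> [\/ E x y, x = y | E y x]
    & forall b, subset_in b a -> (exists x, E x b) ->
        exists2 x, E x b & forall y, E y b -> y = x \/ E x y].

Record ZF : Prop := {
  zf_extensionality : forall x y, (forall z, E z x <-> E z y) -> x = y;
  zf_foundation : forall x, (exists y, E y x) ->
    exists2 y, E y x & forall z, E z x -> ~ E z y;
  zf_pairing : forall x y, exists p, is_upair p x y;
  zf_union : forall x, exists u, forall z, E z u <-> exists2 y, E y x & E z y;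
  zf_powerset : forall x, exists p, forall z, E z p <-> subset_in z x;
  zf_infinity : exists w,
    (exists2 e, E e w & forall z, ~ E z e) /\
    (forall x, E x w ->
      exists2 y, E y w & forall z, E z y <-> E z x \/ z = x);
  zf_separation : forall phi, first_order phi -> forall (s : nat -> M) a,
    exists b, forall x, E x b <-> E x a /\ sat_fo phi (scons x s);
  zf_replacement : forall phi, first_order phi -> forall (s : nat -> M) a,
    (forall x, E x a -> forall y z,
      sat_fo phi (scons x (scons y s)) -> sat_fo phi (scons x (scons z s)) ->
      y = z) ->
    exists b, forall y,
      E y b <-> exists2 x, E x a & sat_fo phi (scons x (scons y s))
}.

Definition app (F : set M) (x y : M) : Prop := exists2 p, F p & is_pair p x y.

Definition class_function (F : set M) : Prop :=
  (forall p, F p -> exists x y, is_pair p x y) /\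
  (forall x y z, app F x y -> app F x z -> y = z).

Definition bijection_V_Ord (F : set M) : Prop :=
  [/\ class_function F,
      forall x, exists2 a, is_ordinal a & app F x a,
      forall x a, app F x a -> is_ordinal a,
      forall x y a, app F x a -> app F y a -> x = y
    & forall a, is_ordinal a -> exists x, app F x a].

Variable X : set (set M).

(* In [gb_comprehension] only the class variables that occur in [phi] have to
   be assigned classes, so instances without class parameters need no class to
   exist beforehand. *)
Record GB : Prop := {
  gb_zf : ZF;
  gb_extensionality : forall A B, X A -> X B ->
    (forall x, A x <-> B x) -> A = B;
  gb_replacement : forall F, X F -> class_function F -> forall a,
    exists b, forall y, E y b <-> exists2 x, E x a & app F x y;
  gb_comprehension : forall phi (s : nat -> M) (S : nat -> set M),
    (forall k, k \in class_vars phi -> X (S k)) ->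
    X [set x | sat phi (scons x s) S]
}.

Record GBC : Prop := {
  gbc_gb : GB;
  gbc_global_choice : exists2 F, X F & bijection_V_Ord F
}.

Definition countable_model : Prop := countable [set: M] /\ countable X.

End Model.

Definition is_minimal {T : Type} (C : set (set T)) (Y : set T) : Prop :=
  C Y /\ forall Z, C Z -> Z `<=` Y -> Z = Y.

(* Main.v *)
(* Global choice well-orders the universe in type Ord; order sets by
   end-extension along this well-order. A condition is a class in X of sets that
   is closed under unions of chains and in which every element has two
   incompatible extensions; a branch is a class with cofinally many initial
   segments in the condition. A fusion argument thins a condition so that a given
   definable family of dense open sets D_w is met uniformly (every sufficiently
   long node lies in D_w). Induction on the formula phi then gives a condition on
   which phi(w, G), for every branch G, is decided by an initial segment of G whose
   length depends only on w; no forcing relation is needed, so the definitions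
   never quantify over classes. Uniformity yields Replacement for classes definable
   from G. If two extensions of every node disagree on the class H defined by phi
   from G, a further thinning makes H determine which way G goes at each node, so
   that G is definable from H; otherwise H is in X above some node. As the model
   is countable, a sequence of conditions of length omega handles all formulas and
   parameters, and X[G] is minimal for the resulting branch G. *)

Require Import Defs.
From mathcomp Require Import all_boot.
From mathcomp Require Import boolp classical_sets cardinality.

Set Implicit Arguments.
Unset Strict Implicit.
Unset Printing Implicit Defensive.

Local Open Scope classical_set_scope.

(** * Definability with class parameters *)

Fixpoint rename_class (f : nat -> nat) (phi : formula) : formula :=
  match phi with
  | f_cmem i k => f_cmem i (f k)
  | f_ceq k l => f_ceq (f k) (f l)
  | f_imp phi psi => f_imp (rename_class f phi) (rename_class f psi)
  | f_all phi => f_all (rename_class f phi)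
  | phi => phi
  end.

Definition lift_renaming (f : nat -> nat) (n : nat) : nat :=
  if n is n'.+1 then (f n').+1 else 0.

Fixpoint rename (f : nat -> nat) (phi : formula) : formula :=
  match phi with
  | f_eq i j => f_eq (f i) (f j)
  | f_mem i j => f_mem (f i) (f j)
  | f_cmem i k => f_cmem (f i) k
  | f_imp phi psi => f_imp (rename f phi) (rename f psi)
  | f_all phi => f_all (rename (lift_renaming f) phi)
  | phi => phi
  end.

Fixpoint var_bound (phi : formula) : nat :=
  match phi with
  | f_eq i j | f_mem i j => maxn i.+1 j.+1
  | f_cmem i _ => i.+1
  | f_imp phi psi => maxn (var_bound phi) (var_bound psi)
  | f_all phi => (var_bound phi).-1
  | _ => 0
  end.

Lemma class_vars_rename_class f phi :
  class_vars (rename_class f phi) = map f (class_vars phi).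
Proof. by elim: phi => //= a iha b ihb; rewrite map_cat iha ihb. Qed.

Lemma class_vars_rename f phi : class_vars (rename f phi) = class_vars phi.
Proof. by elim: phi f => //= a iha b ihb f; rewrite iha ihb. Qed.

Section Definability.
Variables (M : Type) (E : M -> M -> Prop) (x0 : M).
Implicit Types (s c : nat -> M) (S : nat -> set M).

Lemma sat_rename_class f phi s S :
  sat E (rename_class f phi) s S <-> sat E phi s (fun k => S (f k)).
Proof.
elim: phi s => //= [a iha b ihb|a iha] s; first by rewrite iha ihb.
by split => h x; apply/iha.
Qed.

Lemma sat_rename f phi s S :
  sat E (rename f phi) s S <-> sat E phi (fun n => s (f n)) S.
Proof.
elim: phi f s => //= [a iha b ihb|a iha] f s; first by rewrite iha ihb.
have eqs x : (fun n => scons x s (lift_renaming f n)) =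
             scons x (fun n => s (f n)) by apply: funext => -[].
by split => h x; move: (h x); rewrite iha eqs.
Qed.

Lemma sat_eq_env phi s s' S S' :
  (forall n, n < var_bound phi -> s n = s' n) ->
  (forall k, k \in class_vars phi -> S k = S' k) ->
  sat E phi s S <-> sat E phi s' S'.
Proof.
elim: phi s s' => //= [i j|i j|i k|k l|a iha b ihb|a iha] s s' hs hS.
- by rewrite !hs // leq_max leqnn ?orbT.
- by rewrite !hs // leq_max leqnn ?orbT.
- by rewrite hs // hS // inE.
- by rewrite !hS // !inE eqxx ?orbT.
- rewrite (iha s s') ?(ihb s s') // => [n h|k h|n h|k h].
  + by apply: hs; rewrite leq_max h orbT.
  + by apply: hS; rewrite mem_cat h orbT.
  + by apply: hs; rewrite leq_max h.
  + by apply: hS; rewrite mem_cat h.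
- have h x : sat E a (scons x s) S <-> sat E a (scons x s') S'.
    by apply: iha => // -[|n] //= h; apply: hs; move: h; case: var_bound.
  by split => h' x; apply/h.
Qed.

Definition mix s c (n : nat) : M := if odd n then c n./2 else s n./2.

Lemma mix_even s c n : mix s c n.*2 = s n.
Proof. by rewrite /mix odd_double doubleK. Qed.

Lemma mix_odd s c n : mix s c n.*2.+1 = c n.
Proof. by rewrite /mix /= odd_double /= uphalf_double. Qed.

Section Base.
Variable B : set (set M).

(* The parameters are stored in [c], at the odd positions of the assignment. *)
Definition Df (P : (nat -> M) -> Prop) : Prop :=
  exists phi S c, (forall k, k \in class_vars phi -> B (S k)) /\
    forall s, P s <-> sat E phi (mix s c) S.

Lemma Df_ext P Q : (forall s, P s <-> Q s) -> Df P -> Df Q.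
Proof.
move=> h [phi [S [c [hS hP]]]]; exists phi, S, c; split=> // s.
by rewrite -h.
Qed.

Lemma Df_subst (v : nat -> nat + M) P : Df P ->
  Df (fun s => P (fun n => match v n with inl i => s i | inr x => x end)).
Proof.
move=> [phi [S [c [hS hP]]]].
(* Parameter slots are split again by parity: even ones take the substituted constants, odd ones
   keep the old parameters. *)
pose c' := mix (fun n => if v n is inr x then x else x0) c.
pose f n := if odd n then (n./2.*2.+1).*2.+1
            else match v n./2 with inl i => i.*2 | inr _ => (n./2.*2).*2.+1 end.
exists (rename f phi), S, c'; split=> [k|s]; first by rewrite class_vars_rename;
  apply: hS.
rewrite sat_rename hP.
suff -> : mix (fun n => match v n with inl i => s i | inr x => x end) c =
   fun n => mix s c' (f n) by [].
apply: funext => n; rewrite {1}/mix /f; case: ifP => _.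
  by rewrite mix_odd /c' mix_odd.
case e : (v n./2) => [i|x]; first by rewrite mix_even.
by rewrite mix_odd /c' mix_even e.
Qed.

Lemma Df_rename f P : Df P -> Df (fun s => P (fun n => s (f n))).
Proof. exact: (@Df_subst (fun n => inl (f n))). Qed.

Lemma Df_const (p : Prop) : Df (fun=> p).
Proof.
have [hp|hp] := pselect p.
  by exists (f_imp f_false f_false), (fun=> set0), (fun=> x0); split=> //= s; tauto.
by exists f_false, (fun=> set0), (fun=> x0); split=> //= s; tauto.
Qed.

Lemma Df_imp P Q : Df P -> Df Q -> Df (fun s => P s -> Q s).
Proof.
move=> [phi [S [c [hS hP]]]] [psi [S' [c' [hS' hQ]]]].
(* Parity keeps the two formulas apart: the first uses the even class variables and parameter slots,
   the second the odd ones. *)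
pose T k := if odd k then S' k./2 else S k./2.
pose f n := if odd n then (n./2.*2).*2.+1 else n.
pose g n := if odd n then (n./2.*2.+1).*2.+1 else n.
exists (f_imp (rename f (rename_class double phi))
          (rename g (rename_class (fun k => k.*2.+1) psi))), T, (mix c c').
split.
  move=> k /=; rewrite mem_cat !class_vars_rename !class_vars_rename_class.
  case/orP => /mapP [j jin ->]; rewrite /T ?odd_double ?doubleK /= ?odd_double /=.
    exact: hS.
  by rewrite uphalf_double; apply: hS'.
move=> s; rewrite hP hQ /= !sat_rename !sat_rename_class.
have -> : (fun n => mix s (mix c c') (f n)) = mix s c.
  apply: funext => n; rewrite /f; case: (boolP (odd n)) => h.
    by rewrite mix_odd mix_even /mix h.
  by rewrite /mix (negbTE h).
have -> : (fun n => mix s (mix c c') (g n)) = mix s c'.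
  apply: funext => n; rewrite /g; case: (boolP (odd n)) => h.
    by rewrite mix_odd mix_odd /mix h.
  by rewrite /mix (negbTE h).
have -> : (fun k => T k.*2) = S.
  by apply: funext => k; rewrite /T odd_double doubleK.
have -> : (fun k => T k.*2.+1) = S'.
  by apply: funext => k; rewrite /T /= odd_double /= uphalf_double.
by [].
Qed.

Lemma Df_all (P : M -> (nat -> M) -> Prop) :
  Df (fun s => P (s 0) (fun n => s n.+1)) -> Df (fun s => forall x, P x s).
Proof.
move=> [phi [S [c [hS hP]]]].
(* Position 0 is the bound variable. Parameter positions shift up by one under the binder; a
   positive even position also loses one variable index, that is two positions. *)
pose g n := if n is 0 then 0 else if odd n then n.+1 else n.-1.
exists (f_all (rename g phi)), S, c; split=> [k /=|s /=].
  by rewrite class_vars_rename; apply: hS.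
have h x : P x s <-> sat E (rename g phi) (scons x (mix s c)) S.
  rewrite sat_rename (hP (scons x s)).
  suff -> : mix (scons x s) c = (fun n => scons x (mix s c) (g n)) by [].
  apply: funext => -[|n] //; rewrite /g.
  case: (boolP (odd n.+1)) => ho; first by rewrite /= /mix ho.
  move: ho => /=; rewrite negbK => ho; case: n ho => //= n /negbTE ho.
  by rewrite /mix /= ho.
by split=> h' x; apply/h.
Qed.

Lemma Df_not P : Df P -> Df (fun s => ~ P s).
Proof.
move=> hP; apply: Df_imp => //.
exact: Df_const False.
Qed.

Lemma Df_and P Q : Df P -> Df Q -> Df (fun s => P s /\ Q s).
Proof.
move=> hP hQ; apply: (@Df_ext (fun s => ~ (P s -> ~ Q s))).
  by move=> s; split=> [h|[]]; last tauto; apply: contrapT; tauto.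
by apply: Df_not; apply: Df_imp => //; apply: Df_not.
Qed.

Lemma Df_or P Q : Df P -> Df Q -> Df (fun s => P s \/ Q s).
Proof.
move=> hP hQ; apply: (@Df_ext (fun s => ~ P s -> Q s)).
  by move=> s; split=> [h|[]] //; case: (pselect (P s)); tauto.
by apply: Df_imp => //; apply: Df_not.
Qed.

Lemma Df_iff P Q : Df P -> Df Q -> Df (fun s => P s <-> Q s).
Proof. by move=> hP hQ; apply: Df_and; apply: Df_imp. Qed.

Lemma Df_ex (P : M -> (nat -> M) -> Prop) :
  Df (fun s => P (s 0) (fun n => s n.+1)) -> Df (fun s => exists x, P x s).
Proof.
move=> hP; apply: (@Df_ext (fun s => ~ forall x, ~ P x s)).
  move=> s; split=> [h|[x px] h]; last exact: h px.
  by apply: contrapT => h'; apply: h => x px; apply: h'; exists x.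
by apply: Df_not; apply: Df_all; apply: Df_not.
Qed.

Lemma Df_ex2 (P Q : M -> (nat -> M) -> Prop) :
  Df (fun s => P (s 0) (fun n => s n.+1)) ->
  Df (fun s => Q (s 0) (fun n => s n.+1)) ->
  Df (fun s => exists2 x, P x s & Q x s).
Proof.
move=> hP hQ; apply: (@Df_ext (fun s => exists x, P x s /\ Q x s)).
  by move=> s; split=> [[x [? ?]]|[x ? ?]]; exists x.
by apply: Df_ex; apply: Df_and.
Qed.

(* A definable map, given by its graph with the value at index 0. *)
Definition Dt (t : (nat -> M) -> M) : Prop :=
  Df (fun s => s 0 = t (fun n => s n.+1)).

Definition Df1 (A : M -> Prop) : Prop := Df (fun s => A (s 0)).
Definition Df2 (R : M -> M -> Prop) : Prop := Df (fun s => R (s 0) (s 1)).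
Definition Df3 (R : M -> M -> M -> Prop) : Prop :=
  Df (fun s => R (s 0) (s 1) (s 2)).

Lemma Df2_eq : Df2 eq.
Proof. by exists (f_eq 0 2), (fun=> set0), (fun=> x0). Qed.

Lemma Df2_mem : Df2 E.
Proof. by exists (f_mem 0 2), (fun=> set0), (fun=> x0). Qed.

Lemma Df1_class A : B A -> Df1 A.
Proof.
move=> hA; exists (f_cmem 0 0), (fun=> A), (fun=> x0).
by split=> // k _.
Qed.

Lemma Df_app1 A t : Df1 A -> Dt t -> Df (fun s => A (t s)).
Proof.
move=> hA ht; apply: (@Df_ext (fun s => forall x, x = t s -> A x)).
  by move=> s; split=> [h|h x ->] //; apply: h.
by apply: Df_all; apply: Df_imp.
Qed.

Lemma Df_app2 R t u : Df2 R -> Dt t -> Dt u -> Df (fun s => R (t s) (u s)).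
Proof.
move=> hR ht hu.
apply: (@Df_ext (fun s => forall y, y = u s -> forall x, x = t s -> R x y)).
  by move=> s; split=> [h|h y -> x ->] //; apply: h.
apply: Df_all; apply: Df_imp => //; apply: Df_all; apply: Df_imp => //.
exact: (@Df_rename (fun n => if n is n'.+1 then n'.+2 else 0)) ht.
Qed.

Lemma Df_app3 R t u v : Df3 R -> Dt t -> Dt u -> Dt v ->
  Df (fun s => R (t s) (u s) (v s)).
Proof.
move=> hR ht hu hv.
apply: (@Df_ext (fun s => forall z, z = v s -> forall y, y = u s ->
   forall x, x = t s -> R x y z)).
  by move=> s; split=> [h|h z -> y -> x ->] //; apply: h.
apply: Df_all; apply: Df_imp => //; apply: Df_all; apply: Df_imp.
  exact: (@Df_rename (fun n => if n is n'.+1 then n'.+2 else 0)) hu.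
apply: Df_all; apply: Df_imp => //.
exact: (@Df_rename (fun n => if n is n'.+1 then n'.+3 else 0)) ht.
Qed.

Lemma Dt_var i : Dt (fun s => s i).
Proof. exact: (@Df_rename (fun n => if n is 0 then 0 else i.+1)) Df2_eq. Qed.

Lemma Dt_const x : Dt (fun=> x).
Proof. exact: (@Df_subst (fun n => if n is 0 then inl 0 else inr x)) Df2_eq. Qed.

Lemma Df_inst P s : Df P -> Df1 (fun x => P (scons x s)).
Proof.
move=> h; apply: Df_ext (@Df_subst (fun n => if n is n'.+1 then inr (s n') else inl 0) _ h).
move=> s'; set u := (X in P X <-> _).
by have -> : u = scons (s' 0) s by apply: funext => -[].
Qed.

(** Class variables have fixed values here, so an equation between classes is a constant truth
    value. This substitution of definable classes yields comprehension in the extension. *)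
Lemma sat_Df phi S : (forall k, k \in class_vars phi -> Df1 (S k)) ->
  Df (fun s => sat E phi s S).
Proof.
elim: phi => /= [i j|i j|i k|k l||a iha b ihb|a iha] h.
- exact: Df_app2 Df2_eq (Dt_var i) (Dt_var j).
- exact: Df_app2 Df2_mem (Dt_var i) (Dt_var j).
- by apply: Df_app1 (Dt_var i); apply: h; rewrite inE.
- exact: Df_const.
- exact: Df_const.
- apply: Df_imp; [apply: iha|apply: ihb] => k hk; apply: h;
    by rewrite mem_cat hk ?orbT.
- apply: Df_all; apply: Df_ext (iha h) => s.
  by have -> : scons (s 0) (fun n => s n.+1) = s by apply: funext => -[].
Qed.

End Base.

Lemma Df_sub B B' P : B `<=` B' -> Df B P -> Df B' P.
Proof.
by move=> hB [phi [S [c [hS hP]]]]; exists phi, S, c; split=> // k /hS /hB.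
Qed.

End Definability.

(* [dfn] solves goals [Df E B P] by recursion on the shape of P; facts of the
   form [Df1], [Df2], [Df3] are taken from the context. *)
Ltac dt_base x0 := fail.
Ltac dt x0 :=
  cbv beta; first [ assumption | apply (Dt_var _ x0) | dt_base x0;
    dt x0 | apply (Dt_const _ x0) ].
Ltac dfn x0 :=
  cbv beta; first
  [ assumption
  | apply (Df_app2 x0 (Df2_mem _ x0 _)); dt x0
  | apply (Df_app2 x0 (Df2_eq _ x0 _)); dt x0
  | match goal with
    | h : Df1 _ _ _ |- _ => apply (Df_app1 h); dt x0
    | h : Df2 _ _ _ |- _ => apply (Df_app2 x0 h); dt x0
    | h : Df3 _ _ _ |- _ => apply (Df_app3 x0 h); dt x0
    end
  | apply (Df_ex x0); dfn x0
  | apply (Df_ex2 x0); dfn x0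
  | apply (Df_iff x0); dfn x0
  | apply (Df_and x0); dfn x0
  | apply (Df_or x0); dfn x0
  | apply (Df_not x0); dfn x0
  | apply Df_all; dfn x0
  | apply Df_imp; dfn x0
  | apply (Df_const _ x0)
  | idtac ].

(** * Sets and classes of a model of GB *)

Section ClassTheory.
Variables (M : Type) (E : M -> M -> Prop) (x0 : M) (X : set (set M)).
Hypothesis hX : GB E X.

Let hZF : ZF E := gb_zf hX.

Lemma comprehension Z A : GB E Z -> Df1 E Z A -> Z A.
Proof.
move=> hZ [phi [S [c [hS hA]]]].
(* A predicate of one element is read on the constant assignment: every even position becomes
   variable 0, followed by the parameters. *)
pose f n := if odd n then n./2.+1 else 0.
have := gb_comprehension hZ (phi := rename f phi) c (S := S).
rewrite class_vars_rename => /(_ hS).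
suff -> : [set x | sat E (rename f phi) (scons x c) S] = A by [].
apply/predeqP => x /=; rewrite sat_rename (hA (fun=> x)).
suff -> : (fun n => scons x c (f n)) = mix (fun=> x) c by [].
by apply: funext => n; rewrite /f /mix; case: odd.
Qed.

Lemma ext x y : (forall z, E z x <-> E z y) -> x = y.
Proof. exact: (zf_extensionality hZF). Qed.

Lemma is_upair_inj z z' x y : is_upair E z x y -> is_upair E z' x y -> z = z'.
Proof. by move=> h h'; apply: ext => t; rewrite (h t) (h' t). Qed.

Lemma pair_exists x y : exists p, is_pair E p x y.
Proof.
have [z hz] := zf_pairing hZF x x; have [t ht] := zf_pairing hZF x y.
have [p hp] := zf_pairing hZF z t; exists p => u; rewrite (hp u); split.
  by case=> ->; [left|right].
by case=> h; [left|right]; exact: is_upair_inj h _.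
Qed.

Definition opair x y : M := sval (cid (pair_exists x y)).

Lemma opairP x y : is_pair E (opair x y) x y.
Proof. exact: svalP (cid (pair_exists x y)). Qed.

Lemma is_pairE p x y : is_pair E p x y <-> p = opair x y.
Proof.
split=> [h|->]; last exact: opairP.
by apply: ext => z; rewrite (h z) (opairP x y z).
Qed.

Lemma pair_inj x y x' y' : opair x y = opair x' y' -> x = x' /\ y = y'.
Proof.
move=> e; have h := opairP x y; have h' := opairP x' y'; rewrite e in h.
have ex : x = x'.
  have [z hz] := zf_pairing hZF x x.
  have : E z (opair x' y') by apply/h; left.
  by move/h' => -[] hz'; [have : E x' z by apply/hz';
    left|have : E x' z by apply/hz'; left];
    rewrite hz => -[].
subst x'; split=> //.
(* With equal first coordinates, the unordered pair of [x] and [a] must be one of the two members on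
   the other side; both directions together give [y = y']. *)
have key a b : (forall z, is_upair E z x x \/ is_upair E z x a <->
    is_upair E z x x \/ is_upair E z x b) -> a = x \/ a = b.
  move=> hab; have [z hz] := zf_pairing hZF x a.
  have az : E a z by apply/hz; right.
  have : is_upair E z x x \/ is_upair E z x b by apply/hab; right.
  by case=> hz'; move: az; rewrite (hz' a) => -[]; tauto.
have hyy' z : is_upair E z x x \/ is_upair E z x y <->
    is_upair E z x x \/ is_upair E z x y' by rewrite -(h z) -(h' z).
have hy'y z := iff_sym (hyy' z).
by case: (key _ _ hyy') (key _ _ hy'y) => [?|?] [?|?]; congruence.
Qed.

Lemma Df_upair B : Df3 E B (is_upair E).
Proof. by rewrite /Df3 /is_upair; dfn x0. Qed.

Lemma Df_pair B : Df3 E B (is_pair E).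
Proof. rewrite /Df3 /is_pair; have h := Df_upair B; dfn x0. Qed.

Lemma Dt_pair B t u : Dt E B t -> Dt E B u -> Dt E B (fun s => opair (t s) (u s)).
Proof.
move=> ht hu; have h : Df3 E B (fun p x y => p = opair x y).
  by apply: Df_ext (Df_pair B) => s; rewrite is_pairE.
apply: (Df_app3 x0 h); first exact: Dt_var.
  exact: (Df_rename x0 (fun n => if n is n'.+1 then n'.+2 else 0)) ht.
exact: (Df_rename x0 (fun n => if n is n'.+1 then n'.+2 else 0)) hu.
Qed.

End ClassTheory.

Ltac dt_base x0 ::= apply Dt_pair.

(** * Replacement and separation for definable relations *)

Section Replacement.
Variables (M : Type) (E : M -> M -> Prop) (x0 : M) (X : set (set M)).
Hypothesis hX : GB E X.

Let hZF : ZF E := gb_zf hX.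
Local Notation opair := (opair hX).

Lemma repl R a : Df2 E X R ->
  (forall x y y', E x a -> R x y -> R x y' -> y = y') ->
  exists b, forall y, E y b <-> exists2 x, E x a & R x y.
Proof.
move=> hR fR.
(* Restricting the graph to [a] gives a class function although [R] is functional only on [a]. *)
pose F := [set p | exists x y, p = opair x y /\ (E x a /\ R x y)].
have hF : X F by apply: comprehension => //; rewrite /Df1 /F /=; dfn x0.
have appF x y : app E F x y <-> E x a /\ R x y.
  split=> [[p [x' [y' [-> h]]] /(is_pairE hX) e]|h].
    by have [<- <-] := pair_inj e.
  by exists (opair x y); [exists x, y|exact: (opairP hX)].
have [|b hb] := gb_replacement hX hF _ a.
  split=> [p [x [y [-> _]]]|x y z /appF [xa h] /appF [_ h']]; last exact: fR h h'.
  by exists x, y; apply: (opairP hX).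
exists b => y; rewrite hb; split=> [[x xa /appF []]|[x xa h]]; exists x => //.
exact/appF.
Qed.

Lemma sep P a : Df1 E X P -> exists b, forall x, E x b <-> E x a /\ P x.
Proof.
move=> hP; have [||b hb] := @repl (fun x y => x = y /\ P y) a.
- by rewrite /Df2; dfn x0.
- by move=> x y y' _ [<- _] [].
by exists b => y; rewrite hb; split=> [[x xa [<-]]|[xa h]] //; exists y.
Qed.

Definition is_union u c := forall z, E z u <-> exists2 y, E y c & E z y.

Lemma union_exists c : exists u, is_union u c.
Proof. exact: (zf_union hZF). Qed.

Lemma not_universal U : exists x, ~ E x U.
Proof.
have [|r hr] := @sep (fun x => ~ E x x) U; first by rewrite /Df1; dfn x0.
apply: contrapT => h; have all x : E x U by apply: contrapT => ?; apply: h; exists x.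
by have := hr r; have := all r; tauto.
Qed.

Lemma adjoin_exists p u : exists q, forall z, E z q <-> E z p \/ z = u.
Proof.
have [s hs] := zf_pairing hZF u u; have [t ht] := zf_pairing hZF p s.
have [q hq] := union_exists t; exists q => z; rewrite hq; split.
  by case=> y; rewrite (ht y) => -[-> ?|->]; [left|rewrite (hs z); tauto].
case=> [h|->]; first by exists p => //; apply/ht; left.
by exists s; [apply/ht; right|apply/hs; left].
Qed.

End Replacement.

(** * The well-order of the universe given by global choice *)

Section Ordinals.
Variables (M : Type) (E : M -> M -> Prop) (x0 : M) (X : set (set M)).
Hypothesis hX : GB E X.

Lemma ordinal_irrefl a : is_ordinal E a -> ~ E a a.
Proof. by case=> _ h _ _ _ aa; apply: (h a). Qed.

Lemma ordinal_mem a b : is_ordinal E a -> E b a -> is_ordinal E b.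
Proof.
case=> h1 h2 h3 h4 h5 ba; have sub := h1 _ ba; split.
- move=> x xb y yx; apply: (h3 y x b) => //; [|exact: sub].
  by apply: h1 yx; apply: sub.
- by move=> x /sub; apply: h2.
- by move=> x y z /sub xa /sub ya /sub za; apply: h3.
- by move=> x y /sub xa /sub ya; apply: h4.
- by move=> c cb; apply: h5 => x /cb /sub.
Qed.

(* The least element of a outside b is the intersection of a and b. *)
Lemma ordinal_inter_mem a b c : is_ordinal E a -> is_ordinal E b ->
  (forall x, E x c <-> E x a /\ E x b) -> ~ subset_in E a b -> E c a.
Proof.
move=> [a1 a2 a3 a4 a5] [b1 _ _ _ _] hc nsub.
have [|d hd] := @sep _ _ x0 _ hX (fun x => ~ E x b) a.
  by rewrite /Df1; dfn x0.
have [||m md hm] := a5 d.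
- by move=> x /hd [].
- apply: contrapT => h; apply: nsub => x xa; apply: contrapT => xb.
  by apply: h; exists x; apply/hd.
have [ma mb] := (hd m).1 md.
suff -> : c = m by [].
apply: (ext hX) => x; rewrite hc; split=> [[xa xb]|xm].
  case: (a4 _ _ xa ma) => // [e|mx]; first by rewrite e in xb.
  by case: mb; apply: b1 mx.
have xa : E x a by apply: a1 xm.
split=> //; apply: contrapT => xb.
case: (hm x); first exact/hd.
  by move=> e; move: xm; rewrite e; apply: a2.
by move=> mx; apply: (a2 m ma); apply: (a3 m x m).
Qed.

Lemma ordinal_total a b : is_ordinal E a -> is_ordinal E b ->
  [\/ E a b, a = b | E b a].
Proof.
move=> oa ob.
(* [c] is the intersection of [a] and [b]. If neither includes the other, [c] belongs to both, hence
   to itself. *)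
have [|c hc] := @sep _ _ x0 _ hX (fun x => E x b) a.
  by rewrite /Df1; dfn x0.
have cE x y : is_ordinal E x -> is_ordinal E y ->
    (forall z, E z c <-> E z x /\ E z y) -> subset_in E x y -> c = x.
  by move=> ox oy h sub; apply: (ext hX) => z; rewrite h; split=> [[]|zx] //;
    split=> //; exact: sub.
have hc' x : E x c <-> E x b /\ E x a by rewrite hc and_comm.
have [sab|sab] := pselect (subset_in E a b);
  have [sba|sba] := pselect (subset_in E b a).
- by apply: Or32; apply: (ext hX) => z; split; [apply: sab|apply: sba].
- by apply: Or31; rewrite -(cE _ _ oa ob hc sab);
    apply: (ordinal_inter_mem ob oa hc' sba).
- by apply: Or33; rewrite -(cE _ _ ob oa hc' sba);
    apply: (ordinal_inter_mem oa ob hc sab).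
have ca := ordinal_inter_mem oa ob hc sab.
have cb := ordinal_inter_mem ob oa hc' sba.
by case: (ordinal_irrefl (ordinal_mem oa ca)); apply/hc.
Qed.

End Ordinals.

Section WellOrder.
Variables (M : Type) (E : M -> M -> Prop) (x0 : M) (X : set (set M)).
Hypothesis hX : GB E X.
Variable F : set M.
Hypotheses (hF : X F) (bF : bijection_V_Ord E F).
Local Notation opair := (opair hX).

Lemma index_exists x : exists a, is_ordinal E a /\ app E F x a.
Proof. by case: bF => _ h _ _ _; have [a] := h x; exists a. Qed.

Definition index x : M := sval (cid (index_exists x)).

Lemma index_ord x : is_ordinal E (index x).
Proof. by case: (svalP (cid (index_exists x))). Qed.

Lemma indexE x a : a = index x <-> app E F x a.
Proof.
have h : app E F x (index x) by case: (svalP (cid (index_exists x))).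
split=> [->//|h']; case: bF => -[_ f] _ _ _ _; exact: f h' h.
Qed.

Lemma index_inj x y : index x = index y -> x = y.
Proof.
case: bF => _ _ _ i _ e; apply: (i x y (index x)); apply/indexE => //.
Qed.

Lemma Dt_index t : Dt E X t -> Dt E X (fun s => index (t s)).
Proof.
move=> ht; have h : Df2 E X (fun a x => a = index x).
  apply: (@Df_ext _ _ _ (fun s => exists p, F p /\ p = opair (s 1) (s 0))).
    move=> s; rewrite indexE; by split=> [[p [fp e]]|[p fp /(is_pairE hX) e]];
      exists p => //; apply/(is_pairE hX).
  have := Df1_class E x0 hF => hF1.
  by dfn x0.
apply: (Df_app2 x0 h); first exact: Dt_var.
exact: (Df_rename x0 (fun n => if n is n'.+1 then n'.+2 else 0)) ht.
Qed.

Definition lt x y := E (index x) (index y).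

Lemma Df_lt : Df2 E X lt.
Proof. by apply: (Df_app2 x0 (Df2_mem E x0 _)); apply: Dt_index; apply: Dt_var. Qed.

Lemma lt_irrefl x : ~ lt x x.
Proof. exact: ordinal_irrefl (index_ord x). Qed.

Lemma lt_trans y x z : lt x y -> lt y z -> lt x z.
Proof.
by move=> xy; rewrite /lt; case: (index_ord z) => h _ _ _ _ yz; apply: h yz _ xy.
Qed.

Lemma lt_total x y : [\/ lt x y, x = y | lt y x].
Proof.
case: (ordinal_total x0 hX (index_ord x) (index_ord y)) => h.
- exact: Or31. - by apply: Or32; exact: index_inj. - exact: Or33.
Qed.

Lemma lt_least (A : M -> Prop) : Df1 E X A -> (exists x, A x) ->
  exists2 x, A x & forall y, A y -> ~ lt y x.
Proof.
move=> hA [x Ax].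
(* [c] collects the indices below [index x] of members of [A]. Inside an ordinal it has a least
   element unless it is empty, and then [x] itself is least. *)
have [|c hc] := @sep _ _ x0 _ hX (fun b => exists y, A y /\ b = index y) (index x).
  apply: (@Df_ext _ _ _ (fun s => exists y, A y /\ (exists z, z = index y /\ s 0 = z))).
    by move=> s; split=> [[y [ay [z [-> e]]]]|[y [ay e]]]; exists y; split=> //;
      exists (index y).
  have h : Df2 E X (fun a x => a = index x) by apply: Dt_index (Dt_var _ _ _ 0).
  by dfn x0.
have [hne|he] := pselect (exists b, E b c); last first.
  by exists x => // y ay yx; apply: he; exists (index y); apply/hc; split=> //;
    exists y.
have [_ _ _ _ h5] := index_ord x.
have [b /hc [bx [y [ay e]]] hm] := h5 c (fun b h => proj1 ((hc b).1 h)) hne.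
exists y => // z az zy.
have zc : E (index z) c.
  by apply/hc; split; [apply: (lt_trans zy); rewrite /lt -e|exists z].
case: (hm _ zc); rewrite e => h.
  by move: zy; rewrite (index_inj h); apply: lt_irrefl.
by apply: (@lt_irrefl y); apply: lt_trans zy.
Qed.

Lemma lt_initial x : exists a, forall y, E y a <-> lt y x.
Proof.
have hi : Df2 E X (fun a x => a = index x) by apply: Dt_index (Dt_var _ _ _ 0).
have [||a ha] := @repl _ _ x0 _ hX (fun b y => b = index y) (index x).
- by [].
- by move=> b y y' _ -> /index_inj.
by exists a => y; rewrite ha; split=> [[b bx e]|h]; [rewrite /lt -e|exists (index y)].
Qed.

End WellOrder.

(** * Perfect classes of nodes *)

Section Trees.
Variables (M : Type) (E : M -> M -> Prop) (x0 : M) (X : set (set M)).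
Hypothesis hX : GB E X.
Variable lt : M -> M -> Prop.
Hypotheses (Df_lt : Df2 E X lt) (lt_irrefl : forall x, ~ lt x x)
  (lt_trans : forall y x z, lt x y -> lt y z -> lt x z)
  (lt_total : forall x y, [\/ lt x y, x = y | lt y x])
  (lt_least : forall A : M -> Prop, Df1 E X A -> (exists x, A x) ->
     exists2 x, A x & forall y, A y -> ~ lt y x)
  (lt_initial : forall x, exists a, forall y, E y a <-> lt y x).
Implicit Types (p q r a u v w : M) (S : set M).

Lemma le_set v : exists a, forall y, E y a <-> ~ lt v y.
Proof.
have [a ha] := lt_initial v; have [b hb] := adjoin_exists hX a v.
exists b => y; rewrite hb ha; split=> [[h h'|->]|h].
- exact: lt_irrefl (lt_trans h h').
- exact: lt_irrefl.
- by case: (lt_total v y) => // [->|]; [right|left].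
Qed.

(** Replacing each member of an unbounded set by its closed initial segment and taking the union
    would give a universal set. *)
Lemma bounded a : exists v, forall u, E u a -> lt u v.
Proof.
apply: contrapT => nb.
have hU v : exists2 u, E u a & ~ lt u v.
  apply: contrapT => h; apply: nb; exists v => u ua; apply: contrapT => h'.
  by apply: h; exists u.
have [||b hb] := @repl _ _ x0 _ hX (fun u t => forall y, E y t <-> ~ lt u y) a.
- by rewrite /Df2; dfn x0.
- by move=> x y y' _ h h'; apply: (ext hX) => z; rewrite h h'.
have [U hUn] := union_exists hX b.
have [z []] := not_universal x0 hX U; apply/hUn.
have [u ua nuz] := hU z; have [t ht] := le_set u.
by exists t; [apply/hb; exists u|apply/ht].
Qed.

(** Taking the least [v] for each [x] makes the relation functional; Replacement then gives a set of
    witnesses, which is bounded. *)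
Lemma collection R a : Df2 E X R -> (forall x, E x a -> exists v, R x v) ->
  exists v, forall x, E x a -> exists2 v', lt v' v & R x v'.
Proof.
move=> hR tot.
have [||b hb] := @repl _ _ x0 _ hX
    (fun x v => R x v /\ forall v', R x v' -> ~ lt v' v) a.
- by rewrite /Df2; dfn x0.
- move=> x y y' _ [h m] [h' m'].
  by case: (lt_total y y') => // [/(m' _ h)|/(m _ h')].
have [v hv] := bounded b; exists v => x xa.
have [||v' h m] := @lt_least (R x); [by rewrite /Df1; dfn x0|exact: tot|].
by exists v' => //; apply: hv; apply/hb; exists x.
Qed.

Lemma least_ind (P : M -> Prop) : Df1 E X P ->
  (forall x, (forall y, lt y x -> P y) -> P x) -> forall x, P x.
Proof.
move=> hP ih x; apply: contrapT => nx.
have [||m nm hm] := @lt_least (fun x => ~ P x); [by rewrite /Df1;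
  dfn x0|by exists x|].
by apply: nm; apply: ih => y yx; apply: contrapT => /hm.
Qed.

(* Nodes are arbitrary sets, ordered by end-extension along lt. *)
Definition initial (A C : M -> Prop) : Prop :=
  (forall u, A u -> C u) /\ (forall v u, A v -> C u -> ~ A u -> lt v u).

Definition in_ p : set M := [set u | E u p].
Definition le p q : Prop := initial (in_ p) (in_ q).
Definition exceeds v p : Prop := exists2 u, E u p & lt v u.
Definition chain c : Prop := forall a b, E a c -> E b c -> le a b \/ le b a.
Definition nonempty c : Prop := exists a, E a c.

Let Df_le : Df2 E X le.
Proof. by rewrite /Df2 /le /initial /in_ /=; dfn x0. Qed.

Let Df_exceeds : Df2 E X exceeds.
Proof. by rewrite /Df2 /exceeds; dfn x0. Qed.

Let Df_union : Df2 E X (is_union E).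
Proof. by rewrite /Df2 /is_union; dfn x0. Qed.

Let Df_nonempty : Df1 E X nonempty.
Proof. by rewrite /Df1 /nonempty; dfn x0. Qed.

Lemma le_refl p : le p p.
Proof. by split. Qed.

Lemma le_initial p q C : le p q -> initial (in_ q) C -> initial (in_ p) C.
Proof.
move=> [h1 h2] [k1 k2]; split=> [u /h1/k1 //|v u pv cu pu].
have [qu|qu] := pselect (E u q); first exact: h2.
by apply: k2 => //; apply: h1.
Qed.

Lemma le_trans q p t : le p q -> le q t -> le p t.
Proof. exact: le_initial. Qed.

Lemma le_anti p q : le p q -> le q p -> p = q.
Proof. by move=> [h _] [h' _]; apply: (ext hX) => z; split; [apply: h|apply: h']. Qed.

(** If neither were included in the other, an element of [p] outside [q] and one of [q] outside [p]
    would each precede the other. *)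
Lemma initial_linear p q C :
  initial (in_ p) C -> initial (in_ q) C -> le p q \/ le q p.
Proof.
move=> [p1 p2] [q1 q2].
have [sub|nsub] := pselect (forall u, E u p -> E u q).
  by left; split=> // v u pv /q1; apply: p2.
right; have [u up uq] : exists2 u, E u p & ~ E u q.
  apply: contrapT => h; apply: nsub => u up; apply: contrapT => uq.
  by apply: h; exists u.
have sub : forall v, E v q -> E v p.
  move=> v vq; apply: contrapT => vp.
  exact: (@lt_irrefl u) (lt_trans (p2 _ _ up (q1 _ vq) vp) (q2 _ _ vq (p1 _ up) uq)).
by split=> // v t qv /p1; apply: q2.
Qed.

Lemma le_linear p q t : le p t -> le q t -> le p q \/ le q p.
Proof. exact: initial_linear. Qed.

Lemma union_ub c u a : chain c -> is_union E u c -> E a c -> le a u.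
Proof.
move=> hc hu ac; split=> [t ta|v t va]; first by apply/hu; exists a.
rewrite /in_ /= hu => -[b bc tb] ta.
case: (hc _ _ ac bc) => [[_ h]|[h _]]; first exact: h.
by case: ta; apply: h.
Qed.

Lemma union_lub c u (C : M -> Prop) : is_union E u c ->
  (forall a, E a c -> initial (in_ a) C) -> initial (in_ u) C.
Proof.
move=> hu hC; split=> [t /hu [a /hC [h _]]|v t /hu [a ac va] Ct tu]; first exact: h.
have [_ h] := hC _ ac; apply: h => // ta; apply: tu; apply/hu; by exists a.
Qed.

Lemma exceeds_le v p q : le p q -> exceeds v p -> exceeds v q.
Proof. by move=> [h _] [u up vu]; exists u => //; apply: h. Qed.

Lemma exceeds_lt v w p : lt v w -> exceeds w p -> exceeds v p.
Proof. by move=> vw [u up wu]; exists u => //; apply: lt_trans wu. Qed.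

Lemma not_exceeds p : exists v, ~ exceeds v p.
Proof.
have [v hv] := bounded p; exists v => -[u up vu].
exact: (@lt_irrefl v) (lt_trans vu (hv _ up)).
Qed.

Lemma exceeds_union v c u : is_union E u c -> exceeds v u ->
  exists2 a, E a c & exceeds v a.
Proof. by move=> hu [t /hu [a ac ta] vt]; exists a => //; exists t. Qed.

Lemma down_set p : exists d, forall a, E a d <-> le a p.
Proof.
have [P hP] := zf_powerset (gb_zf hX) p.
have [|d hd] := @sep _ _ x0 _ hX (fun a => le a p) P; first by rewrite /Df1; dfn x0.
by exists d => a; rewrite hd hP; split=> [[]|h] //; split=> //; case: h.
Qed.

(** These nodes are the subsets of a closed initial segment, so only set many nodes stay below a
    given length. *)
Lemma small_set v : exists d, forall p, E p d <-> ~ exceeds v p.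
Proof.
have [a ha] := le_set v; have [P hP] := zf_powerset (gb_zf hX) a.
exists P => p; rewrite hP; split=> [h [u /h /ha]|h u up] //.
by apply/ha => vu; apply: h; exists u.
Qed.

Definition chain_closed S : Prop :=
  forall c u, nonempty c -> (forall a, E a c -> S a) -> chain c ->
    is_union E u c -> S u.

Lemma chain_below d p : (forall a, E a d -> le a p) -> chain d.
Proof. by move=> h a b /h ap /h bp; exact: le_linear ap bp. Qed.

(** The common lower bounds in [S] form a set, and a chain because they all lie below [p]; their
    union is the meet. *)
Lemma meet_exists S p p' : Df1 E X S -> chain_closed S ->
  (exists a, [/\ S a, le a p & le a p']) -> exists m,
  [/\ S m, le m p, le m p' & forall a, S a -> le a p -> le a p' -> le a m].
Proof.
move=> Df_S S_chain [r [Sr rp rp']]; have [d hd] := down_set p.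
have [|c hc] := @sep _ _ x0 _ hX (fun a => S a /\ le a p') d.
  by rewrite /Df1; dfn x0.
have hc' a : E a c <-> [/\ S a, le a p & le a p'].
  by rewrite hc hd; split=> [[? []]|[]].
have [m hm] := union_exists hX c.
have cc : chain c by apply: (@chain_below _ p) => a /hc' [].
exists m; split.
- by apply: S_chain cc hm => [|a /hc' []] //; exists r; apply/hc'.
- by apply: union_lub hm _ => a /hc' [].
- by apply: union_lub hm _ => a /hc' [].
- by move=> a ga ap ap'; apply: union_ub cc hm _; apply/hc'.
Qed.

(** * The class generated from a root by successors and unions of chains *)

Section Generated.
Variables (S : set M) (N : M -> M -> Prop) (r : M).
Hypotheses (Df_S : Df1 E X S) (Df_N : Df2 E X N) (S_r : S r)
  (S_chain : chain_closed S)
  (N_S : forall a q, S a -> N a q -> S q)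
  (N_le : forall a q, S a -> N a q -> le a q)
  (N_incomp : forall a q q', S a -> N a q -> N a q' -> q <> q' -> ~ le q q').

(** Closure is required only for nodes below [p], which form a set, so sets [c] suffice to test
    it. *)
Definition closed_below p c : Prop :=
  [/\ le r p -> E r c,
      forall a q, E a c -> N a q -> le q p -> E q c
    & forall d u, nonempty d -> (forall a, E a d -> E a c /\ le a p) ->
        is_union E u d -> E u c].

Definition gen_below p a : Prop := forall c, closed_below p c -> E a c.

(* The closure of r under N and unions of chains. Being generated is witnessed
   below the node itself, which makes this class first-order definable. *)
Definition gen : set M := [set p | gen_below p p].

Let Df_gen_below : Df2 E X gen_below.
Proof.
apply: (@Df_ext _ _ _ (fun s => forall c, ((le r (s 0) -> E r c) /\
   (forall a q, E a c -> N a q -> le q (s 0) -> E q c) /\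
   (forall d u, nonempty d -> (forall a, E a d -> E a c /\ le a (s 0)) ->
        is_union E u d -> E u c)) -> E (s 1) c)).
  by move=> s; split=> h c hc; apply: h; case: hc => ?; [move=> ? ?|case].
by dfn x0.
Qed.

Let Df_gen : Df1 E X gen.
Proof. by rewrite /Df1 /gen /=; dfn x0. Qed.

Lemma gen_below_le p a : gen_below p a -> le a p.
Proof.
have [d hd] := down_set p; move=> /(_ d) h; apply/hd; apply: h; split.
- by move/hd.
- by move=> b q _ _ ?; apply/hd.
- by move=> c u _ h hu; apply/hd; apply: union_lub hu _ => b /h [].
Qed.

Lemma gen_below_root p : le r p -> gen_below p r.
Proof. by move=> h c []; auto. Qed.

Lemma gen_below_succ p a q : gen_below p a -> N a q -> le q p -> gen_below p q.
Proof. by move=> h nq qp c hc; have [_ h' _] := hc; apply: h' nq qp; apply: h. Qed.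

Lemma gen_below_union p d u : nonempty d -> (forall a, E a d -> gen_below p a) ->
  is_union E u d -> gen_below p u.
Proof.
move=> nd hd hu c hc; have [_ _ h] := hc; apply: h nd _ hu => a /hd ha.
by split; [apply: ha|exact: gen_below_le ha].
Qed.

(** The generated nodes satisfying [P] form a set that is again closed, so every generated node lies
    in it. *)
Lemma gen_below_ind p (P : M -> Prop) : Df1 E X P -> (le r p -> P r) ->
  (forall a q, gen_below p a -> P a -> N a q -> le q p -> P q) ->
  (forall d u, nonempty d -> (forall a, E a d -> gen_below p a /\ P a) ->
     is_union E u d -> P u) ->
  forall a, gen_below p a -> P a.
Proof.
move=> DP Pr PN PU a ha; have [d hd] := down_set p.
have [|c hc] := @sep _ _ x0 _ hX (fun a => gen_below p a /\ P a) d.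
  by rewrite /Df1; dfn x0.
suff /hc [_ []] : E a c by [].
apply: ha; split.
- by move=> h; apply/hc; split; [apply/hd|split; [exact: gen_below_root|exact: Pr]].
- move=> b q /hc [_ [gb pb]] nq qp; apply/hc; split; first exact/hd.
  by split; [exact: gen_below_succ gb nq qp|exact: PN gb pb nq qp].
- move=> e u ne he hu; apply/hc; split.
    by apply/hd; apply: union_lub hu _ => b /he [].
  have he' b : E b e -> gen_below p b /\ P b by case/he => /hc [].
  by split; [apply: gen_below_union ne _ hu => b /he' []|exact: PU ne he' hu].
Qed.

Lemma gen_below_sub p p' a : le p p' -> gen_below p a -> gen_below p' a.
Proof.
move=> pp'; apply: gen_below_ind; first by rewrite /Df1; dfn x0.
- by move=> /le_trans h; apply: gen_below_root; apply: h.
- by move=> b q _ hb nq qp; apply: gen_below_succ hb nq (le_trans qp pp').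
- by move=> d u nd hd hu; apply: gen_below_union nd _ hu => b /hd [].
Qed.

Lemma gen_below_S p a : gen_below p a -> S a.
Proof.
apply: gen_below_ind => //; first by move=> b q _ sb nq _; exact: N_S nq.
move=> d u nd hd; apply: S_chain nd _ _ => [b /hd []//|].
by apply: (@chain_below _ p) => b /hd [/gen_below_le].
Qed.

(** Successors only go up, so everything used to generate [a] lies below [a], and the bound can be
    lowered to any [p] above [a]. *)
Lemma gen_below_restrict p p' a : gen_below p' a -> le a p -> gen_below p a.
Proof.
move: a; apply: (@gen_below_ind _ (fun a => le a p -> gen_below p a)).
- by rewrite /Df1; dfn x0.
- by move=> _; apply: gen_below_root.
- move=> b q gb hb nq _ qp; apply: (gen_below_succ _ nq qp); apply: hb.
  by apply: le_trans qp; exact: N_le (gen_below_S gb) nq.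
- move=> d u nd hd hu up; apply: (gen_below_union nd _ hu) => b bd.
  have [_ h] := hd _ bd; apply: h; apply: le_trans up.
  by apply: union_ub hu bd; apply: (@chain_below _ p') => t /hd [/gen_below_le].
Qed.

Lemma gen_S p : gen p -> S p.
Proof. exact: gen_below_S. Qed.

Lemma gen_belowE p a : gen_below p a <-> gen a /\ le a p.
Proof.
split=> [h|[h1 h2]]; last exact: gen_below_sub h1.
have ap := gen_below_le h; split=> //.
exact: gen_below_restrict h (le_refl a).
Qed.

Lemma gen_root : gen r.
Proof. exact: gen_below_root (le_refl r). Qed.

Lemma gen_succ a q : gen a -> N a q -> gen q.
Proof.
move=> ga nq; apply: (gen_below_succ _ nq (le_refl q)); apply/gen_belowE; split=> //.
exact: N_le (gen_S ga) nq.
Qed.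

Lemma gen_chain : chain_closed gen.
Proof.
move=> c u nc hc cc hu; apply: (gen_below_union nc _ hu) => a ac.
by apply/gen_belowE; split; [exact: hc|exact: union_ub cc hu ac].
Qed.

Lemma gen_ind (P : M -> Prop) : Df1 E X P -> P r ->
  (forall a q, gen a -> P a -> N a q -> P q) ->
  (forall d u, nonempty d -> chain d -> (forall a, E a d -> gen a /\ P a) ->
     is_union E u d -> P u) ->
  forall a, gen a -> P a.
Proof.
move=> DP Pr PN PU a; apply: gen_below_ind => //.
  by move=> b q /gen_belowE [gb _] pb nq _; exact: PN gb pb nq.
move=> d u nd hd; apply: PU => //.
  by apply: (@chain_below _ a) => b /hd [/gen_below_le].
by move=> b /hd [/gen_belowE []].
Qed.

Lemma root_le_gen p : gen p -> le r p.
Proof.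
move: p; apply: gen_ind; first by rewrite /Df1; dfn x0.
- exact: le_refl.
- by move=> a q ga ra nq; exact: le_trans ra (N_le (gen_S ga) nq).
- by move=> d u [a ad] cd hd hu; exact: le_trans (hd _ ad).2 (union_ub cd hu ad).
Qed.

Lemma N_unique a q q' p : gen a -> N a q -> N a q' -> le q p -> le q' p -> q = q'.
Proof.
move=> ga nq nq' qp q'p; apply: contrapT => neq; have sa := gen_S ga.
case: (le_linear qp q'p); first exact: N_incomp nq nq' neq.
by apply: N_incomp nq' nq _ => // /esym.
Qed.

(** Induction on [p]. At a successor, no generated node lies strictly between it and its
    predecessor; at a union, some member of the chain already passes beyond [a]. *)
Lemma gen_next p : gen p -> forall a, gen a -> le a p ->
  a = p \/ exists2 q, N a q & le q p.
Proof.
move: p; apply: gen_ind.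
- apply: (@Df_ext _ _ _ (fun s => forall a, gen a -> le a (s 0) -> a = s 0 \/
      exists2 q, N a q & le q (s 0))) => //.
  by dfn x0.
- by move=> a ga ar; left; exact: le_anti ar (root_le_gen ga).
- move=> p p' gp hp np'.
  have inner b : gen b -> le b p' -> le b p \/ le p' b.
    move: b; apply: gen_ind; first by rewrite /Df1; dfn x0.
    + by move=> _; left; exact: root_le_gen.
    + move=> b q gb hb nq qp'.
      have bq := N_le (gen_S gb) nq.
      case: (hb (le_trans bq qp')) => [bp|p'b]; last by right; exact: le_trans p'b bq.
      case: (hp _ gb bp) => [e|[t nt tp]].
        subst b; right; rewrite (N_unique gb nq np' qp' (le_refl _)).
        exact: le_refl.
      left; rewrite (N_unique gb nq nt qp') //.
      exact: le_trans tp (N_le (gen_S gp) np').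
    + move=> d u nd cd hd hu up'.
      have [h|h] := pselect (exists2 b, E b d & le p' b).
        by case: h => b bd p'b; right; exact: le_trans p'b (union_ub cd hu bd).
      left; apply: (union_lub hu) => b bd.
      case: ((hd _ bd).2 (le_trans (union_ub cd hu bd) up')) => // p'b.
      by case: h; exists b.
  move=> a ga ap'; case: (inner a ga ap') => [ap|p'a]; last first.
    by left; exact: le_anti.
  right; case: (hp _ ga ap) => [->|[q nq qp]]; first by exists p' => //;
    exact: le_refl.
  by exists q => //; exact: le_trans qp (N_le (gen_S gp) np').
- move=> d u nd cd hd hu a ga au.
  have [h|h] := pselect (exists2 b, E b d & ~ le b a); last first.
    left; apply: le_anti => //; apply: (union_lub hu) => b bd.
    by apply: contrapT => nba; apply: h; exists b.
  case: h => b bd nba; have bu := union_ub cd hu bd.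
  case: (le_linear au bu) => // ab; have [_ hb] := hd _ bd.
  case: (hb _ ga ab) => [e|[q nq qb]]; first by case: nba; rewrite e; exact: le_refl.
  by right; exists q => //; exact: le_trans qb bu.
Qed.

Lemma gen_class : X gen.
Proof. exact: comprehension hX Df_gen. Qed.

End Generated.

(** * Conditions, thinning and fusion *)

Definition incomp p q : Prop := ~ le p q /\ ~ le q p.

Let Df_incomp : Df2 E X incomp.
Proof. by rewrite /Df2 /incomp; dfn x0. Qed.

Lemma incomp_up p q p' q' : incomp p q -> le p p' -> le q q' -> incomp p' q'.
Proof.
move=> [h1 h2] pp' qq'; split=> h.
  by case: (le_linear (le_trans pp' h) qq').
by case: (le_linear pp' (le_trans qq' h)).
Qed.

Lemma incomp_neq p q q' : incomp q q' -> le p q' -> p <> q.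
Proof. by move=> [h _] h' e; apply: h; rewrite -e. Qed.

Record condition S : Prop := {
  cond_class : X S;
  cond_nonempty : exists p, S p;
  cond_chain : chain_closed S;
  cond_split : forall p, S p -> exists q q',
    [/\ S q, S q', le p q, le p q' & incomp q q'] }.

Lemma cond_Df S : condition S -> Df1 E X S.
Proof. by move=> h; apply: Df1_class => //; exact: cond_class. Qed.

(** Otherwise the extensions of [p] in [S] form a set. Iterating the least proper extension
    generates a chain whose union is again generated, yet has a proper generated successor. *)
Lemma cond_cofinal S p v : condition S -> S p ->
  exists q, [/\ S q, le p q & exceeds v q].
Proof.
move=> cS Sp; apply: contrapT => nbig; have Df_S := cond_Df cS.
pose ext a q := S q /\ le a q /\ a <> q.
have Df_ext2 : Df2 E X ext by rewrite /Df2 /ext; dfn x0.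
pose N a q := ext a q /\ forall q', ext a q' -> ~ lt q' q.
have Df_N : Df2 E X N by rewrite /Df2 /N; dfn x0.
have N_ex a : S a -> exists q, N a q.
  move=> /(cond_split cS) [q [q' [Sq Sq' aq aq' inc]]].
  have [||t ht mt] := @lt_least (ext a); first by rewrite /Df1; dfn x0.
    by exists q; split=> //; split=> //; exact: incomp_neq inc aq'.
  by exists t.
have N_uniq a q q' : N a q -> N a q' -> q = q'.
  move=> [eq mq] [eq' mq']; case: (lt_total q q') => // h.
    by case: (mq' _ eq).
  by case: (mq _ eq').
have N_S a q : S a -> N a q -> S q by move=> _ [[]].
have N_le a q : S a -> N a q -> le a q by move=> _ [[? []]].
have N_neq a q : S a -> N a q -> a <> q by move=> _ [[? []]].
have N_incomp a q q' : S a -> N a q -> N a q' -> q <> q' -> ~ le q q'.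
  by move=> _ h /(N_uniq _ _ _ h).
pose G := gen N p.
have GX : X G := gen_class p Df_N.
have Df_G : Df1 E X G by apply: Df1_class.
have G_S a : G a -> S a by apply: (gen_S Df_S Df_N Sp (cond_chain cS) N_S).
have G_chain : chain_closed G := gen_chain Df_S Df_N Sp (cond_chain cS) N_S N_le.
have G_root a : G a -> le p a := @root_le_gen _ _ _ Df_S Df_N Sp (cond_chain cS) N_S N_le a.
have G_next := gen_next Df_S Df_N Sp (cond_chain cS) N_S N_le N_incomp.
have G_small a : G a -> ~ exceeds v a.
  by move=> ga ea; apply: nbig; exists a; split=> //; [exact: G_S|exact: G_root].
(* Two incomparable generated nodes would both pass through the unique successor of their meet,
   against the maximality of the meet. *)
have G_linear a b : G a -> G b -> le a b \/ le b a.
  move=> ga gb.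
  have [|m [gm ma mb hm]] := meet_exists (p := a) (p' := b) Df_G G_chain.
    by exists p; split; [exact: gen_root|exact: G_root|exact: G_root].
  case: (G_next _ ga _ gm ma) => [<-|[q nq qa]]; first by left.
  case: (G_next _ gb _ gm mb) => [<-|[q' nq' qb]]; first by right.
  rewrite -(N_uniq _ _ _ nq nq') in qb.
  have gq : G q := gen_succ Df_S Df_N Sp (cond_chain cS) N_S N_le gm nq.
  case: (N_neq _ _ (G_S _ gm) nq); apply: le_anti; last exact: hm.
  exact: N_le (G_S _ gm) nq.
have [d hd] := small_set v.
have [g hg] := sep x0 hX d Df_G.
have hg' a : E a g <-> G a.
  by rewrite hg; split=> [[]|ga] //; split=> //; apply/hd; exact: G_small.
have [u hu] := union_exists hX g.
have cg : chain g by move=> a b /hg' ga /hg' gb; exact: G_linear.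
have gu : G u.
  by apply: G_chain cg hu => [|a /hg' //]; exists p; apply/hg'; exact: gen_root.
have [q nq] := N_ex u (G_S _ gu).
have gq : G q := gen_succ Df_S Df_N Sp (cond_chain cS) N_S N_le gu nq.
case: (N_neq _ _ (G_S _ gu) nq); apply: le_anti; first exact: N_le (G_S _ gu) nq.
by apply: union_ub cg hu _; apply/hg'.
Qed.

(** From [r] on, only one pair of incompatible extensions related by [R] is kept at each node, and
    unions of chains are added. The pair becomes the two immediate successors. *)
Lemma thin S r (R : M -> M -> M -> Prop) : condition S -> S r -> Df3 E X R ->
  (forall p, S p -> exists q q',
    [/\ S q, S q', le p q /\ le p q', incomp q q' & R p q q']) ->
  exists S', [/\ condition S', S' `<=` S, S' r, (forall p, S' p -> le r p) &
    forall p, S' p -> exists q q',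
      [/\ S' q /\ S' q', le p q /\ le p q', incomp q q', R p q q' &
        forall p', S' p' -> le p p' -> [\/ p' = p, le q p' | le q' p']]].
Proof.
move=> cS Sr Df_R hR; have Df_S := cond_Df cS.
pose good p q q' := S q /\ S q' /\ le p q /\ le p q' /\ incomp q q' /\ R p q q'.
have Df_good : Df3 E X good by rewrite /Df3 /good; dfn x0.
(* Minimizing first [q] and then [q'] along [lt] selects the pair definably and uniquely. *)
pose pick p q q' := good p q q' /\ (forall t t', good p t t' -> ~ lt t q) /\
  (forall t', good p q t' -> ~ lt t' q').
have Df_pick : Df3 E X pick by rewrite /Df3 /pick; dfn x0.
pose N p q := exists q', pick p q q' \/ pick p q' q.
have Df_N : Df2 E X N by rewrite /Df2 /N; dfn x0.
have pick_ex p : S p -> exists q q', pick p q q'.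
  move=> /hR [q [q' [Sq Sq' [pq pq'] inc Rq]]].
  have [||t [t' gt] mt] := @lt_least (fun q => exists q', good p q q').
  - by rewrite /Df1; dfn x0.
  - by exists q, q'.
  have [||z gz mz] := @lt_least (fun q' => good p t q').
  - by rewrite /Df1; dfn x0.
  - by exists t'.
  by exists t, z; split=> //; split=> // x x' gx; apply: mt; exists x'.
have pick_uniq p q q' t t' : pick p q q' -> pick p t t' -> q = t /\ q' = t'.
  move=> [g [m m']] [h [n n']].
  have e : q = t.
    by case: (lt_total q t) => // l; [case: (n _ _ g)|case: (m _ _ h)].
  subst t; split=> //.
  by case: (lt_total q' t') => // l; [case: (n' _ g)|case: (m' _ h)].
have N_S a q : S a -> N a q -> S q by move=> _ [q' [] [[? []]]].
have N_le a q : S a -> N a q -> le a q by move=> _ [q' [] [[? [? [? []]]]]].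
have N_incomp a q q' : S a -> N a q -> N a q' -> q <> q' -> ~ le q q'.
  move=> _ [t h] [t' h'].
  case: h => h; case: h' => h'; have [e e'] := pick_uniq _ _ _ _ _ h h'; subst => //.
    by case: h => [[? [? [? [? [[i1 i2] _]]]]]] _.
  by case: h => [[? [? [? [? [[i1 i2] _]]]]]] _.
have gS a : gen N r a -> S a := @gen_S _ _ _ Df_S Df_N Sr (cond_chain cS) N_S a.
have gsucc := gen_succ Df_S Df_N Sr (cond_chain cS) N_S N_le.
have gsplit p : gen N r p -> exists q q',
      [/\ gen N r q /\ gen N r q', le p q /\ le p q', incomp q q', R p q q' &
        forall p', gen N r p' -> le p p' -> [\/ p' = p, le q p' | le q' p']].
  move=> gp; have [q [q' h]] := pick_ex p (gS _ gp); exists q, q'.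
  have [[_ [_ [pq [pq' [inc Rq]]]]] _] := h; split=> //.
    by split; apply: (gsucc _ _ gp); [exists q'; left|exists q; right].
  move=> p' gp' pp'.
  case: (gen_next Df_S Df_N Sr (cond_chain cS) N_S N_le N_incomp gp' gp pp').
    by move=> ->; apply: Or31.
  by move=> [t [t' [] /(pick_uniq _ _ _ _ _ h) [? ?]]] tp'; subst;
    [apply: Or32|apply: Or33].
exists (gen N r); split=> //.
- split.
  + exact: gen_class.
  + by exists r; apply: gen_root.
  + exact: gen_chain Df_S Df_N Sr (cond_chain cS) N_S N_le.
  + move=> p /gsplit [q [q' [[gq gq'] [pq pq'] inc _ _]]].
    by exists q, q'.
- exact: gen_root.
- by move=> p; apply: (root_le_gen Df_S Df_N Sr (cond_chain cS) N_S N_le).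
Qed.

Lemma exceeds_max v w : exists t, forall p, exceeds t p -> exceeds v p /\ exceeds w p.
Proof.
case: (lt_total v w) => [l|e|l].
- by exists w => p h; split=> //; exact: exceeds_lt h.
- by exists v => p h; rewrite -e.
- by exists v => p h; split=> //; exact: exceeds_lt h.
Qed.

(** Fusion: after thinning, both successors of a node meet the first [D w] that the node misses.
    Induction on [w] then bounds the length by which [D w] is met. *)
Lemma hit S (D : M -> M -> Prop) : condition S -> Df2 E X D ->
  (forall w p, S p -> exists q, [/\ S q, le p q & D w q]) ->
  (forall w p q, S p -> S q -> le p q -> D w p -> D w q) ->
  exists S', [/\ condition S', S' `<=` S &
    forall w, exists v, forall p, S' p -> exceeds v p -> D w p].
Proof.
move=> cS Df_D dense mono; have [r Sr] := cond_nonempty cS.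
pose R p q q' := forall w, (forall w', lt w' w -> D w' p) -> D w q /\ D w q'.
have Df_R : Df3 E X R by rewrite /Df3 /R; dfn x0.
have [p Sp|S' [cS' S'S S'r rS' next]] := thin cS Sr Df_R.
  have [q [q' [Sq Sq' pq pq' inc]]] := cond_split cS Sp.
  have [all|nall] := pselect (forall w, D w p).
    by exists q, q'; split=> // w _; split; apply: mono (all w).
  have [||w0 nw0 mw0] := @lt_least (fun w => ~ D w p).
  - by rewrite /Df1; dfn x0.
  - by apply: contrapT => h; apply: nall => w; apply: contrapT => ?; apply: h;
      exists w.
  have [t [St qt Dt]] := dense w0 q Sq; have [t' [St' qt' Dt']] := dense w0 q' Sq'.
  exists t, t'; split=> //.
  - by split; [exact: le_trans pq qt|exact: le_trans pq' qt'].
  - exact: incomp_up inc qt qt'.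
  move=> w hw; case: (lt_total w w0) => [l|->|l] //; last by case: nw0; exact: hw.
  have Dw : D w p by apply: contrapT => /mw0.
  by split; apply: mono Dw => //; [exact: le_trans pq qt|exact: le_trans pq' qt'].
exists S'; split=> //; have Df_S' := cond_Df cS'.
have mono' w p q : S' p -> S' q -> le p q -> D w p -> D w q.
  by move=> /S'S ? /S'S ?; apply: mono.
apply: least_ind; first by rewrite /Df1; dfn x0.
move=> w ih.
have [I hI] := lt_initial w.
(* By induction, nodes exceeding [v0] lie in [D w'] for every [w'] before [w]. *)
have [||v0 hv0] := @collection (fun w v => forall p, S' p -> exceeds v p -> D w p) I.
- by rewrite /Df2; dfn x0.
- by move=> w' /hI /ih.
have D0 p : S' p -> exceeds v0 p -> forall w', lt w' w -> D w' p.
  move=> S'p ep w' /hI /hv0 [v' lv h]; apply: h => //; exact: exceeds_lt ep.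
have [d hd] := small_set v0.
have [c hc] := sep x0 hX d Df_S'.
(* [b] bounds both successors of [p]; over the set of nodes not exceeding [v0], these bounds are
   collected below one [v1]. *)
pose B p b := exists q q', ((S' q /\ ~ exceeds b q /\ le p q /\ q <> p) /\
   (S' q' /\ ~ exceeds b q' /\ le p q' /\ q' <> p) /\
   (forall p', S' p' -> le p p' -> p' = p \/ le q p' \/ le q' p')).
have [||v1 hv1] := @collection B c.
- by rewrite /Df2 /B; dfn x0.
- move=> p /hc [_ S'p]; have [q [q' [[S'q S'q'] [pq pq'] inc _ hn]]] := next _ S'p.
  have [b hb] := not_exceeds q; have [b' hb'] := not_exceeds q'.
  have [b2 hb2] := exceeds_max b b'.
  exists b2, q, q'; split; [|split].
  + split=> //; split; first by move/hb2 => [].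
    by split=> //; apply/nesym/(incomp_neq inc pq').
  + split=> //; split; first by move/hb2 => [].
    by split=> //; apply/nesym/(incomp_neq (proj1 (and_comm _ _) inc) pq).
  by move=> p' sp' pp'; case: (hn _ sp' pp'); tauto.
(* [v2] separates [p] from the root, for the case in which the root already exceeds [v0]. *)
have [v2 hv2] := not_exceeds r; have [v3 hv3] := exceeds_max v0 v2.
have [v4 hv4] := exceeds_max v1 v3.
exists v4 => p S'p /hv4 [ep1 /hv3 [ep0 ep2]].
(* p2 is the first node below p exceeding v0 *)
suff [p2 [S'p2 p2p e2 ne]] : exists p2, [/\ S' p2, le p2 p, exceeds v0 p2 & p <> p2].
  have [q [q' [[S'q S'q'] _ _ Rq hn]]] := next _ S'p2.
  have [Dq Dq'] := Rq w (D0 _ S'p2 e2).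
  case: (hn _ S'p p2p) => // le; [exact: mono' le Dq|exact: mono' le Dq'].
have [er|ner] := pselect (exceeds v0 r).
  by exists r; split=> //; [exact: rS'|move=> e; apply: hv2; rewrite -e].
(* [p1] will be the largest node of [S'] below [p] not exceeding [v0]. Its successor below [p]
   exceeds [v0], and differs from [p] because it does not exceed [b] while [p] does. *)
have [dp hdp] := down_set p.
have [|c1 hc1] := @sep _ _ x0 _ hX (fun a => S' a /\ ~ exceeds v0 a) dp.
  by rewrite /Df1; dfn x0.
have [p1 hp1] := union_exists hX c1.
have cc1 : chain c1 by apply: (@chain_below _ p) => a /hc1 [/hdp].
have S'p1 : S' p1.
  apply: (cond_chain cS') cc1 hp1 => [|a /hc1 [_ []]//].
  by exists r; apply/hc1; split; [apply/hdp; exact: rS'|].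
have np1 : ~ exceeds v0 p1 by move/(exceeds_union hp1) => [a /hc1 [_ []]].
have p1p : le p1 p by apply: union_lub hp1 _ => a /hc1 [/hdp].
have [|b lb [q [q' [[S'q [nq [pq qp]]] [[S'q' [nq' [pq' q'p]]] hn]]]]] := hv1 p1.
  by apply/hc; split=> //; apply/hd.
have epb : exceeds b p := exceeds_lt lb ep1.
have fin t : S' t -> ~ exceeds b t -> le p1 t -> t <> p1 -> le t p ->
    exists p2, [/\ S' p2, le p2 p, exceeds v0 p2 & p <> p2].
  move=> S't nt p1t tp1 tp; exists t; split=> //.
    apply: contrapT => net; apply: tp1; apply: le_anti p1t.
    by apply: union_ub cc1 hp1 _; apply/hc1; split; [apply/hdp|].
  by move=> e; apply: nt; rewrite -e.
case: (hn _ S'p p1p) => [e|[h|h]]; [by case: np1; rewrite -e| |].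
  exact: (fin q).
exact: (fin q').
Qed.

Lemma cone_condition S r : condition S -> S r -> condition [set p | S p /\ le r p].
Proof.
move=> cS Sr; have Df_S := cond_Df cS; split.
- by apply: comprehension hX _; rewrite /Df1 /=; dfn x0.
- by exists r; split=> //; exact: le_refl.
- move=> c u nc hc cc hu; split.
    by apply: (cond_chain cS) nc _ cc hu => a /hc [].
  by have [a ac] := nc; exact: le_trans (hc _ ac).2 (union_ub cc hu ac).
- move=> p [Sp rp]; have [q [q' [Sq Sq' pq pq' inc]]] := cond_split cS Sp.
  by exists q, q'; split=> //; split=> //; exact: le_trans rp _.
Qed.

Lemma full_condition : condition setT.
Proof.
split=> //; first by apply: comprehension hX _; exact: Df_const.
  by exists x0.
(* With [v] above [p] and [w] above [v], adding [v] or [w] to [p] gives incompatible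
   end-extensions. *)
move=> p _; have [v hv] := bounded p.
have above t : exists u, lt t u.
  have [s hs] := zf_pairing (gb_zf hX) t t.
  by have [u hu] := bounded s; exists u; apply: hu; apply/hs; left.
have [w vw] := above v.
have [q hq] := adjoin_exists hX p v; have [q' hq'] := adjoin_exists hX p w.
have vp : ~ E v p by move/hv; exact: lt_irrefl.
have wp : ~ E w p by move/hv/(lt_trans vw); exact: lt_irrefl.
have nvw : v <> w by move=> e; move: vw; rewrite e; exact: lt_irrefl.
exists q, q'; split=> //.
- split=> [u up|t u tp]; rewrite /in_ /= hq; first by left.
  by case=> // -> _; exact: hv.
- split=> [u up|t u tp]; rewrite /in_ /= hq'; first by left.
  by case=> // -> _; apply: lt_trans vw; exact: hv.
- split=> -[h _].
    have /h : in_ q v by apply/hq; right.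
    by case/hq'.
  have /h : in_ q' w by apply/hq'; right.
  by case/hq => // /esym.
Qed.

Definition branch S (G : set M) : Prop :=
  forall v, exists p, [/\ S p, initial (in_ p) G & exceeds v p].

Lemma branch_sub S S' G : S' `<=` S -> branch S' G -> branch S G.
Proof. by move=> h hb v; have [p [/h ? ? ?]] := hb v; exists p. Qed.

(** * Deciding formulas along branches *)

Local Notation opair := (opair hX).

Definition is_opair w := exists x y, w = opair x y.
(** Outside pairs both projections return their argument, so they are total with definable graphs
    and can be iterated freely. *)
Definition fst_ w : M := if pselect (is_opair w) is left h then sval (cid h) else w.
Definition snd_ w : M :=
  if pselect (is_opair w) is left h then sval (cid (svalP (cid h))) else w.

Lemma pair_projs w : is_opair w -> w = opair (fst_ w) (snd_ w).
Proof.
rewrite /fst_ /snd_ => h0; case: pselect => // h.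
exact: svalP (cid (svalP (cid h))).
Qed.

Lemma fst_pair x y : fst_ (opair x y) = x.
Proof.
have /pair_projs e : is_opair (opair x y) by exists x, y.
by have [<- _] := pair_inj e.
Qed.

Lemma snd_pair x y : snd_ (opair x y) = y.
Proof.
have /pair_projs e : is_opair (opair x y) by exists x, y.
by have [_ <-] := pair_inj e.
Qed.

Lemma Dt_fst t : Dt E X t -> Dt E X (fun s => fst_ (t s)).
Proof.
move=> ht; have h : Df2 E X (fun u w => u = fst_ w).
  apply: (@Df_ext _ _ _ (fun s => (exists y, s 1 = opair (s 0) y) \/
     ~ (exists x y, s 1 = opair x y) /\ s 0 = s 1)); last by dfn x0.
  move=> s; split=> [[[y ->]|[h ->]]|->]; first by rewrite fst_pair.
    by rewrite /fst_; case: pselect.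
  have [h|h] := pselect (is_opair (s 1)).
    by left; exists (snd_ (s 1)); exact: pair_projs.
  by right; split=> //; rewrite /fst_; case: pselect.
apply: (Df_app2 x0 h); first exact: Dt_var.
exact: (Df_rename x0 (fun n => if n is n'.+1 then n'.+2 else 0)) ht.
Qed.

Lemma Dt_snd t : Dt E X t -> Dt E X (fun s => snd_ (t s)).
Proof.
move=> ht; have h : Df2 E X (fun u w => u = snd_ w).
  apply: (@Df_ext _ _ _ (fun s => (exists x, s 1 = opair x (s 0)) \/
     ~ (exists x y, s 1 = opair x y) /\ s 0 = s 1)); last by dfn x0.
  move=> s; split=> [[[y ->]|[h ->]]|->]; first by rewrite snd_pair.
    by rewrite /snd_; case: pselect.
  have [h|h] := pselect (is_opair (s 1)).
    by left; exists (fst_ (s 1)); exact: pair_projs.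
  by right; split=> //; rewrite /snd_; case: pselect.
apply: (Df_app2 x0 h); first exact: Dt_var.
exact: (Df_rename x0 (fun n => if n is n'.+1 then n'.+2 else 0)) ht.
Qed.

(* An element of M codes an assignment, as an iterated pair. *)
Definition decode w (n : nat) : M := fst_ (iter n snd_ w).

Lemma decode_pair x w : decode (opair x w) = scons x (decode w).
Proof.
apply: funext => -[|n]; first exact: fst_pair.
by rewrite /decode iterSr snd_pair.
Qed.

Lemma encode (s : nat -> M) N : exists w, forall n, n < N -> decode w n = s n.
Proof.
elim: N s => [|N ih] s; first by exists x0.
have [w hw] := ih (fun n => s n.+1).
by exists (opair (s 0) w) => -[|n] h; rewrite decode_pair //=; apply: hw.
Qed.

Lemma Dt_decode n t : Dt E X t -> Dt E X (fun s => decode (t s) n).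
Proof.
move=> ht; apply: Dt_fst; elim: n => [|n ih] //=; exact: Dt_snd.
Qed.

Ltac dt_base x0 ::= first [apply Dt_pair | apply Dt_decode].

(** [Pos] and [Neg] take the place of forcing. The length in [dec_total] depends on [w] alone, so
    every branch contains a deciding node. *)
Record decides S (P : M -> set M -> Prop) (Pos Neg : M -> M -> Prop) : Prop := {
  Df_Pos : Df2 E X Pos;
  Df_Neg : Df2 E X Neg;
  pos_mono : forall w p q, S p -> S q -> le p q -> Pos w p -> Pos w q;
  neg_mono : forall w p q, S p -> S q -> le p q -> Neg w p -> Neg w q;
  dec_consistent : forall w p, S p -> Pos w p -> ~ Neg w p;
  dec_total : forall w, exists v, forall p, S p -> exceeds v p -> Pos w p \/ Neg w p;
  pos_sound : forall w p G, S p -> branch S G -> initial (in_ p) G -> Pos w p -> P w G;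
  neg_sound : forall w p G, S p -> branch S G -> initial (in_ p) G -> Neg w p -> ~ P w G }.

Definition decidable S P : Prop := exists Pos Neg, decides S P Pos Neg.

Lemma decides_sub S S' P Pos Neg : S' `<=` S -> decides S P Pos Neg ->
  decides S' P Pos Neg.
Proof.
move=> sub [h1 h2 h3 h4 h5 h6 h7 h8]; split=> //.
- by move=> w p q /sub ? /sub ?; apply: h3.
- by move=> w p q /sub ? /sub ?; apply: h4.
- by move=> w p /sub; apply: h5.
- by move=> w; have [v hv] := h6 w; exists v => p /sub; apply: hv.
- by move=> w p G /sub ? /(branch_sub sub); apply: h7.
- by move=> w p G /sub ? /(branch_sub sub); apply: h8.
Qed.

Lemma decides_ext S P Q Pos Neg : (forall w G, P w G <-> Q w G) ->
  decides S P Pos Neg -> decides S Q Pos Neg.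
Proof.
move=> e [h1 h2 h3 h4 h5 h6 h7 h8]; split=> // w p G *; rewrite -e;
  [exact: (h7 w p)|exact: (h8 w p)].
Qed.

Lemma decides_pos S P Pos Neg w G : decides S P Pos Neg -> branch S G -> P w G ->
  exists p, [/\ S p, initial (in_ p) G & Pos w p].
Proof.
move=> d bG pw; have [v hv] := dec_total d w; have [p [Sp pG ep]] := bG v.
exists p; split=> //; case: (hv p Sp ep) => // /(neg_sound d Sp bG pG).
by case.
Qed.

Lemma decides_neg S P Pos Neg w G : decides S P Pos Neg -> branch S G -> ~ P w G ->
  exists p, [/\ S p, initial (in_ p) G & Neg w p].
Proof.
move=> d bG pw; have [v hv] := dec_total d w; have [p [Sp pG ep]] := bG v.
exists p; split=> //; case: (hv p Sp ep) => // /(pos_sound d Sp bG pG).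
by [].
Qed.

Lemma decidable_static S (Q : M -> Prop) : Df1 E X Q -> decidable S (fun w _ => Q w).
Proof.
move=> DQ; exists (fun w _ => Q w), (fun w _ => ~ Q w); split=> //.
- by rewrite /Df2; dfn x0.
- by move=> w p _ h; apply.
- by move=> w; exists x0 => p _ _; exact: EM.
Qed.

(** [G] end-extends [p], so membership of [x] is settled once [p] contains or passes [x]. *)
Lemma initial_mem x p (G : M -> Prop) : initial (in_ p) G ->
  E x p \/ exceeds x p -> E x p <-> G x.
Proof.
move=> [h1 h2] h; split=> [/h1 //|Gx]; apply: contrapT => nx.
case: h => // -[u up xu]; exact: (@lt_irrefl x) (lt_trans xu (h2 _ _ up Gx nx)).
Qed.

(** With [Q] true this is membership in [G]; quantified over all elements it becomes the equation of
    [G] with a given class. *)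
Lemma decidable_atom S i (Q : M -> Prop) : Df1 E X Q ->
  decidable S (fun w G => G (decode w i) <-> Q w).
Proof.
move=> DQ.
pose K w p := E (decode w i) p \/ exceeds (decode w i) p.
have DK : Df2 E X K by rewrite /Df2 /K; dfn x0.
have Kmono w p q : le p q -> K w p -> K w q.
  by move=> pq [h|h]; [left; exact: pq.1|right; exact: exceeds_le h].
exists (fun w p => K w p /\ (E (decode w i) p <-> Q w)),
  (fun w p => K w p /\ ~ (E (decode w i) p <-> Q w)); split.
- by rewrite /Df2; dfn x0.
- by rewrite /Df2; dfn x0.
- move=> w p q _ _ pq [k h]; split; first exact: Kmono k.
  by have := initial_mem pq k; rewrite /in_ /=; tauto.
- move=> w p q _ _ pq [k h]; split; first exact: Kmono k.
  by have := initial_mem pq k; rewrite /in_ /=; tauto.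
- by move=> w p _ [_ h] [].
- move=> w; exists (decode w i) => p _ ep.
  have k : K w p by right.
  by have := EM (E (decode w i) p <-> Q w); tauto.
- by move=> w p G _ _ pG [k]; rewrite (initial_mem pG k).
- by move=> w p G _ _ pG [k]; rewrite (initial_mem pG k).
Qed.

Lemma decidable_imp S P Q : decidable S P -> decidable S Q ->
  decidable S (fun w G => P w G -> Q w G).
Proof.
move=> [Pos [Neg d]] [Pos' [Neg' d']].
exists (fun w p => Neg w p \/ Pos' w p), (fun w p => Pos w p /\ Neg' w p); split.
- by have := Df_Neg d => ?; have := Df_Pos d' => ?; rewrite /Df2; dfn x0.
- by have := Df_Pos d => ?; have := Df_Neg d' => ?; rewrite /Df2; dfn x0.
- move=> w p q Sp Sq pq [h|h]; [left; exact: (neg_mono d) h|right;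
    exact: (pos_mono d') h].
- move=> w p q Sp Sq pq [h h']; split;
    [exact: (pos_mono d) h|exact: (neg_mono d') h'].
- by move=> w p Sp [h|h] [k k'];
    [exact: (dec_consistent d) k h|exact: (dec_consistent d') h k'].
- move=> w; have [v hv] := dec_total d w; have [v' hv'] := dec_total d' w.
  have [t ht] := exceeds_max v v'; exists t => p Sp /ht [e e'].
  by case: (hv p Sp e) (hv' p Sp e'); tauto.
- move=> w p G Sp bG pG [h|h] k; last exact: (pos_sound d') h.
  by case: (neg_sound d Sp bG pG h k).
- move=> w p G Sp bG pG [h h'] k; apply: (neg_sound d' Sp bG pG h'); apply: k.
  exact: (pos_sound d) h.
Qed.

(** Either some extension of a node has a witness or none has. The alternatives are dense and
    persist upwards, so fusion applies. *)
Lemma hit_ex S (Q : M -> M -> Prop) : condition S -> Df2 E X Q ->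
  (forall w p q, S p -> S q -> le p q -> Q w p -> Q w q) ->
  exists S', [/\ condition S', S' `<=` S & forall w, exists v, forall p, S' p ->
    exceeds v p -> (exists x, Q (opair x w) p) \/
      (forall q, S q -> le p q -> forall x, ~ Q (opair x w) q)].
Proof.
move=> cS DQ mono; have Df_S := cond_Df cS; apply: hit => //.
- by rewrite /Df2; dfn x0.
- move=> w p Sp.
  have [h|h] := pselect (exists q x, [/\ S q, le p q & Q (opair x w) q]).
    by case: h => q [x [Sq pq Qx]]; exists q; split=> //; left; exists x.
  exists p; split; [by []|exact: le_refl|].
  by right=> q Sq pq x Qx; apply: h; exists q, x.
- move=> w p q Sp Sq pq [[x Qx]|h]; first by left; exists x; exact: mono Qx.
  by right=> t St qt; apply: h => //; exact: le_trans qt.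
Qed.

Lemma decidable_all S P : condition S -> decidable S P ->
  exists S', [/\ condition S', S' `<=` S &
    decidable S' (fun w G => forall x, P (opair x w) G)].
Proof.
move=> cS [Pos [Neg d]]; have Df_S := cond_Df cS; have D2 := Df_Neg d.
have [S' [cS' sub hS']] := hit_ex cS D2 (neg_mono d).
exists S'; split=> //.
(* The universal statement counts as true at [p] when no extension in the original [S] refutes an
   instance; a refuting node on the branch would be comparable with [p]. *)
exists (fun w p => forall q, S q -> le p q -> forall x, ~ Neg (opair x w) q),
  (fun w p => exists x, Neg (opair x w) p); split.
- by rewrite /Df2; dfn x0.
- by rewrite /Df2; dfn x0.
- by move=> w p q _ _ pq h t St qt; apply: h => //; exact: le_trans qt.
- by move=> w p q /sub Sp /sub Sq pq [x h]; exists x; exact: (neg_mono d) h.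
- by move=> w p /sub Sp h [x k]; apply: (h p) k => //; exact: le_refl.
- by move=> w; have [v hv] := hS' w; exists v => p S'p ep; case: (hv p S'p ep); tauto.
- move=> w p G /sub Sp /(branch_sub sub) bG pG h x; apply: contrapT => nP.
  have [q [Sq qG nq]] := decides_neg d bG nP.
  case: (initial_linear pG qG) => [pq|qp]; first exact: h nq.
  by apply: (h p Sp (le_refl p) x); exact: (neg_mono d) nq.
- move=> w p G /sub Sp /(branch_sub sub) bG pG [x h] k.
  exact: (neg_sound d Sp bG pG h).
Qed.

Lemma decidable_sub S S' P : S' `<=` S -> decidable S P -> decidable S' P.
Proof. by move=> sub [Pos [Neg d]]; exists Pos, Neg; exact: decides_sub d. Qed.

Lemma decidable_ext S P Q : (forall w G, P w G <-> Q w G) ->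
  decidable S P -> decidable S Q.
Proof. by move=> e [Pos [Neg d]]; exists Pos, Neg; exact: decides_ext d. Qed.

Lemma decidable_eq_class S A : condition S -> Df1 E X A ->
  exists S', [/\ condition S', S' `<=` S & decidable S' (fun _ G => G = A)].
Proof.
move=> cS DA.
have [|S' [cS' sub d]] := decidable_all cS (@decidable_atom S 0 (fun w => A (decode w 0)) _).
  by rewrite /Df1; dfn x0.
exists S'; split=> //; apply: decidable_ext d => w G; split=> [h|-> x] //.
by apply/predeqP => x; have := h x; rewrite decode_pair.
Qed.

(** Class variable 0 stands for [G], the others for [L]. The condition is quantified after the
    formula so that subformulas can thin it successively. *)
Lemma decidable_formula phi L : (forall k, Df1 E X (L k)) ->
  forall S, condition S -> exists S', [/\ condition S', S' `<=` S &
    decidable S' (fun w G => sat E phi (decode w) (scons G L))].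
Proof.
move=> DL; elim: phi => [i j|i j|i k|k l||a iha b ihb|a iha] S cS.
- exists S; split=> //;
    apply: (@decidable_static S (fun w => decode w i = decode w j)).
  by rewrite /Df1; dfn x0.
- exists S; split=> //;
    apply: (@decidable_static S (fun w => E (decode w i) (decode w j))).
  by rewrite /Df1; dfn x0.
- exists S; split=> //; case: k => [|k] /=.
    apply: decidable_ext (@decidable_atom S i (fun=> True) _); last exact: Df_const.
    by move=> w G; tauto.
  by apply: (@decidable_static S (fun w => L k (decode w i))); have := DL k => ?;
    rewrite /Df1; dfn x0.
- case: k l => [|k] [|l] /=.
  + exists S; split=> //.
    by apply: decidable_ext (@decidable_static S (fun=> True) _) => //;
      exact: Df_const.
  + exact: decidable_eq_class.
  + have [S' [? ? d]] := decidable_eq_class cS (DL k); exists S'; split=> //.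
    by apply: decidable_ext d => w G; split=> /esym.
  + by exists S; split=> //; apply: (@decidable_static S (fun=> L k = L l));
      exact: Df_const.
- by exists S; split=> //; apply: (@decidable_static S (fun=> False));
    exact: Df_const.
- have [S1 [c1 s1 d1]] := iha S cS; have [S2 [c2 s2 d2]] := ihb S1 c1.
  exists S2; split=> //; first exact: subset_trans s1.
  by apply: decidable_imp d2; exact: decidable_sub d1.
- have [S1 [c1 s1 d1]] := iha S cS; have [S2 [c2 s2 d2]] := decidable_all c1 d1.
  exists S2; split=> //; first exact: subset_trans s1.
  by apply: decidable_ext d2 => w G /=; split=> h x; move: (h x); rewrite decode_pair.
Qed.

(** * Generic branches *)

(** Of two incompatible nodes at most one is an initial segment of [A]; the cone above the other
    avoids [A]. *)
Lemma avoid_class S (A : set M) : condition S ->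
  exists S', [/\ condition S', S' `<=` S & forall G, branch S' G -> G <> A].
Proof.
move=> cS; have [p Sp] := cond_nonempty cS.
have [q [q' [Sq Sq' _ _ [i1 i2]]]] := cond_split cS Sp.
have [t St nt] : exists2 t, S t & ~ initial (in_ t) A.
  have [h|h] := pselect (initial (in_ q) A); last by exists q.
  by exists q' => // h'; case: (initial_linear h h').
exists [set p | S p /\ le t p]; split; [exact: cone_condition|by move=> ? []|].
move=> G bG e; have [a [[_ ta] aG _]] := bG x0.
by apply: nt; rewrite -e; exact: le_initial aG.
Qed.

(** Either above some [r] no two nodes disagree about the class, and [X] computes it from the
    decisions made there; or thinning puts a disagreement at every splitting, so that the class
    determines the branch. *)
Lemma minimal_step S P w0 : condition S -> decidable S P ->
  exists S', [/\ condition S', S' `<=` S & forall G, branch S' G ->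
    X [set x | P (opair x w0) G] \/
    forall Z, GB E Z -> X `<=` Z -> Z [set x | P (opair x w0) G] -> Z G].
Proof.
move=> cS [Pos [Neg d]]; have Df_S := cond_Df cS.
have D1 := Df_Pos d; have D2 := Df_Neg d.
have [[r [Sr agree]]|split_] := pselect (exists r, S r /\ forall x q q',
    S q -> S q' -> le r q -> le r q' -> Pos (opair x w0) q -> ~ Neg (opair x w0) q').
  pose S' : set M := [set p | S p /\ le r p].
  have sub : S' `<=` S by move=> ? [].
  exists S'; split=> //; first exact: cone_condition.
  move=> G bG; left; have d' := decides_sub sub d.
  have -> : [set x | P (opair x w0) G] =
      [set x | exists q, S q /\ le r q /\ Pos (opair x w0) q].
    apply/predeqP => x; split=> [h|[q [Sq [rq h]]]].
      by have [p [[Sp rp] _ hp]] := decides_pos d' bG h; exists p.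
    apply: contrapT => nP; have [p [[Sp rp] _ np]] := decides_neg d' bG nP.
    exact: agree h np.
  by apply: comprehension hX _; rewrite /Df1 /=; dfn x0.
have [r Sr] := cond_nonempty cS.
pose R (p q q' : M) := exists x, Pos (opair x w0) q /\ Neg (opair x w0) q'.
have Df_R : Df3 E X R by rewrite /Df3 /R; dfn x0.
have [p Sp|S' [cS' sub S'r rS' next]] := thin cS Sr Df_R.
  apply: contrapT => h; apply: split_; exists p;
    split=> // x q q' Sq Sq' pq pq' hq hq'.
  apply: h; exists q, q'; split=> //; last by exists x.
  (* Disagreeing nodes are incomparable, since decisions persist upwards and are consistent. *)
  split=> l.
    exact: (dec_consistent d) Sq' (pos_mono d Sq Sq' l hq) hq'.
  exact: (dec_consistent d) Sq hq (neg_mono d Sq' Sq l hq').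
exists S'; split=> // G bG; right=> Z hZ XZ ZH.
have d' := decides_sub sub d; set H := [set x | P (opair x w0) G] in ZH *.
(* [K p] says that all decisions at [p] are correct for [H]; in [S'] this singles out the initial
   segments of [G]. *)
pose K p := forall x, (Pos (opair x w0) p -> H x) /\ (Neg (opair x w0) p -> ~ H x).
have Gall p : S' p -> initial (in_ p) G -> K p.
  move=> S'p pG x; split=> h; first exact: (pos_sound d') S'p bG pG h.
  exact: (neg_sound d') S'p bG pG h.
have Kinit p : S' p -> K p -> initial (in_ p) G.
  move=> S'p Kp; apply: contrapT => npG.
  (* A longer node [g] on the branch parts from [p] at their meet [m]. The successors of [m] below
     [p] and [g] disagree on some [x], so [p] and [g] cannot both be right about [H]. *)
  have [v hv] := not_exceeds p; have [g [S'g gG eg]] := bG v.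
  have Kg := Gall _ S'g gG.
  have npg : ~ le p g by move=> pg; apply: npG; exact: le_initial gG.
  have ngp : ~ le g p by move=> gp; apply: hv; exact: exceeds_le eg.
  have [|m [S'm mp mg hm]] := meet_exists (p := p) (p' := g) (cond_Df cS') (cond_chain cS').
    by exists r; split=> //; exact: rS'.
  have [q [q' [[S'q S'q'] [mq mq'] inc [x [hx hx']] hn]]] := next _ S'm.
  have mq_ t t' : incomp t t' -> le m t' -> S' t -> le m t -> le t p -> ~ le t g.
    move=> i mt' S't mt tp tg; apply: (incomp_neq i mt'); apply: le_anti => //.
    exact: hm.
  case: (hn _ S'p mp) => [e|qp|q'p]; first by case: npg; rewrite e.
    case: (hn _ S'g mg) => [e|qg|q'g]; first by case: ngp; rewrite e.
      by case: (mq_ _ _ inc mq' S'q mq qp qg).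
    have hp := pos_mono d' S'q S'p qp hx; have hg := neg_mono d' S'q' S'g q'g hx'.
    exact: (Kg x).2 hg ((Kp x).1 hp).
  case: (hn _ S'g mg) => [e|qg|q'g]; first by case: ngp; rewrite e.
    have hp := neg_mono d' S'q' S'p q'p hx'; have hg := pos_mono d' S'q S'g qg hx.
    exact: (Kp x).2 hp ((Kg x).1 hg).
  by case: (mq_ _ _ (proj1 (and_comm _ _) inc) mq S'q' mq' q'p q'g).
have -> : G = [set u | exists p, S' p /\ E u p /\ K p].
  apply/predeqP => u; split=> [Gu|[p [S'p [up /(Kinit _ S'p) [h _]]]]]; last exact: h.
  have [p [S'p pG ep]] := bG u; exists p; split=> //; split; last exact: Gall.
  by apply/(initial_mem pG) => //; right.
have [D3 D4 D5 D6] : [/\ Df1 E Z S', Df1 E Z H, Df2 E Z (fun x p => Pos (opair x w0) p) &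
    Df2 E Z (fun x p => Neg (opair x w0) p)].
  split; [|exact: Df1_class| |]; apply: (Df_sub XZ).
  - exact: cond_Df.
  - by dfn x0.
  - by dfn x0.
apply: comprehension hZ _; rewrite /Df1 /K /=.
apply: (@Df_ext _ _ _ (fun s => exists p, S' p /\ E (s 0) p /\
  forall x, ((fun x p => Pos (opair x w0) p) x p -> H x) /\
            ((fun x p => Neg (opair x w0) p) x p -> ~ H x))) => //.
move: D5 D6; set A := (fun x p => Pos _ _); set B := (fun x p => Neg _ _) => D5 D6.
by dfn x0.
Qed.

(** Collection bounds the lengths needed for all [x] in [a], so one node of the branch settles the
    function on [a], and Replacement in [X] applies to its decisions. *)
Lemma replacement_step S P w0 : condition S -> decidable S P ->
  exists S', [/\ condition S', S' `<=` S & forall G, branch S' G ->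
    class_function E [set x | P (opair x w0) G] -> forall a, exists b, forall y,
      E y b <-> exists2 x, E x a & app E [set x | P (opair x w0) G] x y].
Proof.
move=> cS [Pos [Neg d]]; have Df_S := cond_Df cS; have D1 := Df_Pos d.
(* The code holds the value at position 0 and the argument at position 1; [x0] pads it below. *)
pose Q w p := Pos (opair (opair (decode w 1) (decode w 0)) w0) p.
have DQ : Df2 E X Q by rewrite /Df2 /Q; dfn x0.
have [|S' [cS' sub hS']] := hit_ex cS DQ; first by move=> w; exact: (pos_mono d).
have Df_S' := cond_Df cS';
  have QE x y p : Q (opair y (opair x x0)) p <-> Pos (opair (opair x y) w0) p.
  by rewrite /Q !decode_pair.
exists S'; split=> // G bG fG a; set F := [set x | P (opair x w0) G] in fG *.
have bG' := branch_sub sub bG.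
have [||v hv] := @collection (fun x v => forall p, S' p -> exceeds v p ->
    (exists y, Q (opair y (opair x x0)) p) \/
    (forall q, S q -> le p q -> forall y, ~ Q (opair y (opair x x0)) q)) a.
- by rewrite /Df2; dfn x0.
- by move=> x _; exact: hS'.
have [p [S'p pG ep]] := bG v; have Sp := sub _ S'p.
have appF x y : app E F x y <-> F (opair x y).
  by split=> [[t Ft /(is_pairE hX) <-]|h] //; exists (opair x y) => //;
    exact: (opairP hX).
have posF x y : Pos (opair (opair x y) w0) p -> app E F x y.
  by move=> h; apply/appF; exact: (pos_sound d) Sp bG' pG h.
have [||b hb] := @repl _ _ x0 _ hX (fun x y => Pos (opair (opair x y) w0) p) a.
- by rewrite /Df2; dfn x0.
- by move=> x y y' _ /posF h /posF h'; exact: fG.2 h h'.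
exists b => y; rewrite hb; split=> [[x xa /posF h]|[x xa h]]; exists x => //.
have [v' lv hp] := hv _ xa.
have [q [Sq qG hq]] := decides_pos d bG' ((appF _ _).1 h).
case: (hp p S'p (exceeds_lt lv ep)) => [[y' /QE h']|no].
  by rewrite (fG.2 _ _ _ h (posF _ _ h')).
case: (initial_linear pG qG) => [pq|qp].
  by case: (no q Sq pq y); apply/QE.
by case: (no p Sp (le_refl p) y); apply/QE; exact: (pos_mono d) hq.
Qed.

Definition generic_for phi L w0 (G : set M) : Prop :=
  let H := [set x | sat E phi (decode (opair x w0)) (scons G L)] in
  (X H \/ forall Z, GB E Z -> X `<=` Z -> Z H -> Z G) /\
  (class_function E H -> forall a, exists b, forall y,
      E y b <-> exists2 x, E x a & app E H x y).

Lemma generic_step phi L w0 A v S : (forall k, X (L k)) -> condition S ->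
  exists S', [/\ condition S', S' `<=` S,
    exists r, [/\ S' r, forall p, S' p -> le r p & exceeds v r] &
    forall G, branch S' G -> generic_for phi L w0 G /\ G <> A].
Proof.
move=> XL cS; have DL k : Df1 E X (L k) by apply: Df1_class.
have [S1 [c1 s1 d1]] := decidable_formula phi DL cS.
have [S2 [c2 s2 h2]] := minimal_step w0 c1 d1.
have [S3 [c3 s3 h3]] := replacement_step w0 c2 (decidable_sub s2 d1).
have [S4 [c4 s4 h4]] := avoid_class A c3.
have [p Sp] := cond_nonempty c4.
(* The cone above a node longer than [v] commits every branch to that length. *)
have [r [Sr _ er]] := cond_cofinal v c4 Sp.
have s5 : [set p | S4 p /\ le r p] `<=` S4 by move=> ? [].
exists [set p | S4 p /\ le r p]; split.
- exact: cone_condition.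
- by move=> t /s5/s4/s3/s2/s1.
- by exists r; split=> // p' [].
move=> G /(branch_sub s5) b4; have b3 := branch_sub s4 b4.
have b2 := branch_sub s3 b3; split; last exact: h4.
by split; [exact: h2|exact: h3].
Qed.

(** The conditions decrease along an omega-sequence and [G] is the union of their roots. The roots
    exceed every length, so [G] is a branch of each condition. *)
Lemma generic_exists (phi : nat -> formula) (L : nat -> nat -> set M)
    (w v : nat -> M) (A : nat -> set M) :
  (forall n k, X (L n k)) -> (forall x, exists n, v n = x) ->
  exists G, forall n, generic_for (phi n) (L n) (w n) G /\ G <> A n.
Proof.
move=> XL vsurj.
pose step n (T : {S | condition S}) : {S | condition S} :=
  let h := cid (generic_step (phi n) (w n) (A n) (v n) (XL n) (svalP T)) in
  exist _ (sval h) (let: And4 c _ _ _ := svalP h in c).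
pose T := fix T n := if n is n'.+1 then step n' (T n') else exist _ _ full_condition.
pose U n : set M := sval (T n).
have stepP n := svalP (cid (generic_step (phi n) (w n) (A n) (v n) (XL n) (svalP (T n)))).
have dec n : U n.+1 `<=` U n by case: (stepP n).
have /choice [r hr] n : exists r,
    [/\ U n.+1 r, forall p, U n.+1 p -> le r p & exceeds (v n) r].
  by case: (stepP n).
have decle n m : n <= m -> U m `<=` U n.
  move=> /subnK <-; elim: (m - n) => // k ih x.
  by rewrite addSn => /dec /ih.
have rle n m : n <= m -> le (r n) (r m).
  by move=> nm; have [_ h _] := hr n; apply: h; apply: (@decle _ m.+1) => //;
    case: (hr m).
pose G : set M := [set u | exists n, E u (r n)].
have rG n : initial (in_ (r n)) G.
  split=> [u ur|x u xr [m um] nu]; first by exists n.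
  case: (leqP n m) => [/rle [_ h]|/ltnW /rle [h _]]; first exact: h.
  by case: nu; exact: h.
have bG n : branch (U n) G.
  (* Index [maxn n k] puts the root both inside [U n] and beyond [v k]. *)
  move=> x; have [k <-] := vsurj x; exists (r (maxn n k)); split=> //.
    by apply: (@decle _ (maxn n k).+1);
      [rewrite leqW // leq_maxl|case: (hr (maxn n k))].
  have [_ _ e] := hr k; apply: exceeds_le e; apply: rle; exact: leq_maxr.
by exists G => n; case: (stepP n) => _ _ _; apply; exact: (bG n.+1).
Qed.

End Trees.

(** * The extension by a generic branch *)

Lemma countable_enum (T : Type) (A : set T) a0 : countable A -> A a0 ->
  exists e : nat -> T, (forall n, A (e n)) /\ (forall a, A a -> exists n, e n = a).
Proof.
move=> /countable_injP [f finj] Aa0.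
(* [e n] has [f]-value [n] whenever some element of [A] does; [a0] witnesses the remaining case. *)
have /choice [e he] n : exists a, A a /\ ((exists2 b, A b & f b = n) -> f a = n).
  have [[b Ab fb]|h] := pselect (exists2 b, A b & f b = n); first by exists b.
  by exists a0; split.
exists e; split=> [n|a Aa]; first by case: (he n).
exists (f a); have [Ae h] := he (f a); apply: finj; rewrite ?inE //.
by apply: h; exists a.
Qed.

(** Trees with labels in [nat] form a countable type, so an injection into them makes formulas
    enumerable. *)
Fixpoint tree_of_formula (phi : formula) : GenTree.tree nat :=
  let leaf := @GenTree.Leaf nat in
  match phi with
  | f_eq i j => GenTree.Node 0 [:: leaf i; leaf j]
  | f_mem i j => GenTree.Node 1 [:: leaf i; leaf j]
  | f_cmem i j => GenTree.Node 2 [:: leaf i; leaf j]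
  | f_ceq i j => GenTree.Node 3 [:: leaf i; leaf j]
  | f_false => GenTree.Node 4 [::]
  | f_imp phi psi => GenTree.Node 5 [:: tree_of_formula phi; tree_of_formula psi]
  | f_all phi => GenTree.Node 6 [:: tree_of_formula phi]
  end.

Lemma tree_of_formula_inj : injective tree_of_formula.
Proof.
elim=> [i j|i j|i j|i j||a iha b ihb|a iha] [i' j'|i' j'|i' j'|i' j'||a' b'|a'] //=.
- by case=> -> ->.
- by case=> -> ->.
- by case=> -> ->.
- by case=> -> ->.
- by case=> /iha -> /ihb ->.
- by case=> /iha ->.
Qed.

(** A triple describes a class definable from [G]: a formula, the indices of its class parameters,
    and the index of a set coding its set parameters. *)
Lemma formula_index_enum : exists e : nat -> formula * seq nat * nat,
  forall t, exists n, e n = t.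
Proof.
pose f (t : formula * seq nat * nat) := pickle (tree_of_formula t.1.1, t.1.2, t.2).
have finj : injective f.
  move=> [[a l] n] [[b l'] n'] /(pcan_inj pickleK) [e -> ->].
  by rewrite (tree_of_formula_inj e).
have cT : countable [set: formula * seq nat * nat].
  by apply/countable_injP; exists f => ? ? _ _; exact: finj.
have [e [_ he]] := countable_enum cT (Logic.I : setT (f_false, [::], 0)).
by exists e => t; exact: he.
Qed.

(** * Classes definable from the generic branch *)

Section Extension.
Variables (M : Type) (E : M -> M -> Prop) (x0 : M) (X : set (set M)).
Hypothesis hX : GB E X.
Variables (e : nat -> set M) (G : set M).
Hypothesis e_surj : forall A, X A -> exists n, e n = A.

Definition extension : set (set M) := [set A | Df1 E (X `|` [set G]) A].

(** A formula has finitely many variables, so one set codes all set parameters and a finite list all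
    class parameters from [X]. *)
Lemma extension_normal_form A : extension A -> exists phi l w,
  A = [set x | sat E phi (decode hX (opair hX x w)) (scons G (fun k => e (nth 0 l k)))].
Proof.
move=> [phi [S [c [hS hA]]]].
pose f n := if odd n then n./2.+1 else 0.
(* Class variables assigned [G] become 0; all others move up by one. *)
pose g k := if pselect (S k = G) then 0 else k.+1.
have /choice [j hj] k : exists n, X (S k) -> e n = S k.
  have [/e_surj [n hn]|h] := pselect (X (S k)); first by exists n.
  by exists 0.
pose psi := rename f (rename_class g phi).
have [w hw] := encode x0 hX c (var_bound psi).
exists psi, (mkseq j (\max_(k <- class_vars phi) k).+1), w.
apply/predeqP => x; rewrite (hA (fun=> x)) /=.
rewrite (@sat_eq_env _ _ psi _ (scons x c) _ (scons G (fun k => e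
  (nth 0 (mkseq j (\max_(k <- class_vars phi) k).+1) k)))) //; last first.
  by rewrite decode_pair => -[|n] //= h; apply: hw; exact: ltnW.
rewrite sat_rename sat_rename_class.
have -> : (fun n => scons x c (f n)) = mix (fun=> x) c.
  by apply: funext => n; rewrite /f /mix; case: odd.
apply: sat_eq_env => // k kin; rewrite /g; case: pselect => // nG /=.
rewrite nth_mkseq; last by rewrite ltnS; exact: leq_bigmax_seq.
by case: (hS k kin) => // Xk; rewrite hj.
Qed.

Lemma extension_comprehension phi s S :
  (forall k, k \in class_vars phi -> extension (S k)) ->
  extension [set x | sat E phi (scons x s) S].
Proof. by move=> h; apply: (Df_inst x0 s (sat_Df x0 h)). Qed.

Lemma extension_sub : X `<=` extension.
Proof. by move=> A XA; apply: (Df1_class E x0); left. Qed.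

Lemma extension_generic : extension G.
Proof. by apply: (Df1_class E x0); right. Qed.

Lemma extension_least Z : GB E Z -> X `<=` Z -> Z G -> extension `<=` Z.
Proof.
move=> hZ XZ ZG A hA; apply: comprehension hZ _; apply: Df_sub hA.
by move=> B [/XZ //|->].
Qed.

End Extension.

Theorem theorem2 (M : Type) (E : M -> M -> Prop) (X : set (set M))
    (hX : GBC E X) (hc : countable_model X) :
  exists Y : set (set M), is_minimal [set Y | GBC E Y /\ X `<` Y] Y.
Proof.
have [cM cX] := hc; have hG := gbc_gb hX; have [F XF bF] := gbc_global_choice hX.
have [_ [[x0 _ _] _]] := zf_infinity (gb_zf hG).
have [eM [_ eM_surj]] := countable_enum cM (Logic.I : setT x0).
have [eX [eX_X eX_surj]] := countable_enum cX XF.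
have [ix ix_surj] := formula_index_enum.
(* Requirement [n] treats the [n]-th triple and, through [eX], keeps [G] different from the [n]-th
   class; the first [eM] supplies parameters, the second lengths. *)
have [n k|x|G hGen] := @generic_exists _ _ x0 _ hG (lt bF) (Df_lt x0 hG XF bF)
  (@lt_irrefl _ _ _ bF) (@lt_trans _ _ _ bF) (lt_total x0 hG bF)
  (lt_least x0 hG XF bF) (lt_initial x0 hG XF bF)
  (fun n => (ix n).1.1) (fun n k => eX (nth 0 (ix n).1.2 k))
  (fun n => eM (ix n).2) eM eX.
- exact: eX_X.
- exact: eM_surj.
pose Y := extension E X G.
have XY : X `<=` Y by exact: (extension_sub E x0).
have YG : Y G by exact: (extension_generic E x0).
have nXG : ~ X G by move=> /eX_surj [n eG]; case: (hGen n) => _; rewrite eG.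
have normal A : Y A -> exists phi L w,
    generic_for hG phi L w G /\
    A = [set x | sat E phi (decode hG (opair hG x w)) (scons G L)].
  move=> /(extension_normal_form x0 hG eX_surj) [phi [l [w ->]]].
  have [m em] := eM_surj w Logic.I; have [n en] := ix_surj (phi, l, m).
  exists phi, (fun k => eX (nth 0 l k)), w; split=> //.
  by have [] := hGen n; rewrite en /= em.
have Y_GBC : GBC E Y.
  split; last by exists F => //; exact: XY.
  split.
  - exact: gb_zf hG.
  - by move=> A B _ _ h; apply/predeqP.
  - move=> A /normal [phi [L [w [[_ h] ->]]]]; exact: h.
  - by move=> phi s S h; apply: extension_comprehension.
exists Y; split=> [|Z [hZ [XZ nZX]] ZY].
  by split=> //; split=> // YX; apply: nXG; exact: YX.
(* Any [H] in [Z] outside [X] recovers [G]: it has a normal form as a class of [Y], and the first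
   alternative of the dichotomy is excluded. *)
have [H ZH nXH] : exists2 H, Z H & ~ X H.
  apply: contrapT => h; apply: nZX => A ZA; apply: contrapT => nA.
  by apply: h; exists A.
have [phi [L [w [[h _] eH]]]] := normal H (ZY _ ZH).
have ZG : Z G.
  case: h; rewrite -eH // => h; exact: h (gbc_gb hZ) XZ ZH.
apply/seteqP; split=> //; exact: extension_least (gbc_gb hZ) XZ ZG.
Qed.
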